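(* Let $x$ be an algebraic complex number of the form $x=e^{te^{-t}}$ where $t\in\mathbb{C}$ satisfies $|t|<1$ or $t$ is a root of unity, so that the iterated exponential sequence $x,\ x^x,\ x^{x^x},\ldots$ converges to $h(x)=e^{t}$. If $h(x)$ is algebraic, then $x$ is a positive real number.
   Context: For $x=e^{te^{-t}}$, powers $x^y$ are defined by $x^y:=e^{y\,te^{-t}}$; with this convention (Baker–Rippon) the sequence $x,\ x^x,\ x^{x^x},\ldots$ converges to $e^t$ whenever $|t|<1$ or $t$ is a root of unity, and $h(x)$ denotes this limit. *)

(* Defs.v *)
From Stdlib Require Import Reals ZArith List.
Open Scope R_scope.

Definition Cplx : Type := (R * R)%type.
Definition C0 : Cplx := (0, 0).
Definition C1 : Cplx := (1, 0).
Definition Cadd (z w : Cplx) : Cplx := (fst z + fst w, snd z + snd w).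
Definition Copp (z : Cplx) : Cplx := (- fst z, - snd z).
Definition Cmul (z w : Cplx) : Cplx :=
  (fst z * fst w - snd z * snd w, fst z * snd w + snd z * fst w).
Fixpoint Cpow (z : Cplx) (n : nat) : Cplx :=
  match n with O => C1 | S m => Cmul z (Cpow z m) end.
Definition Cnorm2 (z : Cplx) : R := fst z * fst z + snd z * snd z.
Definition Cexp (z : Cplx) : Cplx := (exp (fst z) * cos (snd z), exp (fst z) * sin (snd z)).
Definition CofZ (k : Z) : Cplx := (IZR k, 0).

Definition Peval (p : list Z) (z : Cplx) : Cplx :=
  fold_right (fun a acc => Cadd (CofZ a) (Cmul z acc)) C0 p.

Definition is_algebraic (z : Cplx) : Prop :=
  exists p : list Z, (exists a, In a p /\ a <> 0%Z) /\ Peval p z = C0.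

Definition root_of_unity (t : Cplx) : Prop :=
  exists n : nat, (1 <= n)%nat /\ Cpow t n = C1.

(* The Baker--Rippon power convention: for x = e^(t e^(-t)), x^y := e^(y t e^(-t)).
   tower t n is the n-th term x, x^x, x^(x^x), ... (n = 0 gives x).
   (Documentation only: by the context, this converges to h(x) = e^t.) *)
Definition BR_log (t : Cplx) : Cplx := Cmul t (Cexp (Copp t)).
Fixpoint tower (t : Cplx) (n : nat) : Cplx :=
  match n with
  | O => Cexp (BR_log t)
  | S m => Cexp (Cmul (tower t m) (BR_log t))
  end.

(* Main.v *)
(* Put h = e^t and b = e^(-t) = 1/h. If h is algebraic then so is b, and x = e^(b t) is a
   value of h^b. By the Gelfond-Schneider theorem, x algebraic forces b to be rational
   (or t = 0); a real e^(-t) with |Im t| <= 1 < pi forces t to be real, so x > 0.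

   Gelfond-Schneider is proved by Gelfond's method. With the weights w = i + j b, Siegel's
   lemma gives small integers c_w for which F(z) = \sum_w c_w e^(w t z) vanishes to order n
   at 0, ..., M - 1. Let s be the least order of a nonvanishing derivative there (s is finite
   because the weights are distinct). Then F^(s)(m) / t^s is small by a Schwarz lemma, and it
   is not too small because, up to a denominator, it is an eigenvalue of an integer matrix of
   fixed size with controlled entries. Complex analysis is avoided by measuring a power
   series by its weighted l^1 norm \sum_k |a_k| R^k: division by z - x decreases
   it by the factor R - |x|. *)

Require Import Defs.
From Stdlib Require Import Reals ZArith List Lra Lia Classical.
From Coquelicot Require Import Rcomplements Hierarchy Derive AutoDerive.
Open Scope R_scope.

(** * The complex exponential *)

Lemma Cnorm2_mul z w : Cnorm2 (Cmul z w) = Cnorm2 z * Cnorm2 w.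
Proof. unfold Cnorm2, Cmul; simpl; ring. Qed.

Lemma Cnorm2_pow z n : Cnorm2 (Cpow z n) = Cnorm2 z ^ n.
Proof.
  induction n as [|n IH]; simpl; [unfold Cnorm2, C1; simpl; ring|].
  now rewrite Cnorm2_mul, IH.
Qed.

Lemma root_of_unity_norm z : root_of_unity z -> Cnorm2 z <= 1.
Proof.
  intros [n [n_ge1 zn]].
  destruct (Rle_lt_dec (Cnorm2 z) 1) as [|gt1]; [assumption|].
  assert (lt : 1 < Cnorm2 z ^ n) by (apply Rlt_pow_R1; [assumption|lia]).
  rewrite <- Cnorm2_pow, zn in lt; unfold Cnorm2, C1 in lt; simpl in lt; lra.
Qed.

Lemma Cexp_add z w : Cexp (Cadd z w) = Cmul (Cexp z) (Cexp w).
Proof.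
  unfold Cexp, Cadd, Cmul; simpl.
  rewrite exp_plus, cos_plus, sin_plus; f_equal; ring.
Qed.

(** Submultiplicative like the modulus, but free of square roots. *)
Definition Cl1 (z : Cplx) : R := Rabs (fst z) + Rabs (snd z).

Lemma Cl1_mul z w : Cl1 (Cmul z w) <= Cl1 z * Cl1 w.
Proof.
  unfold Cl1, Cmul; simpl.
  pose proof (Rabs_triang (fst z * fst w) (- (snd z * snd w))) as H1.
  pose proof (Rabs_triang (fst z * snd w) (snd z * fst w)) as H2.
  rewrite Rabs_Ropp in H1; unfold Rminus; rewrite !Rabs_mult in *; lra.
Qed.

Lemma Cl1_pow z n : Cl1 (Cpow z n) <= Cl1 z ^ n.
Proof.
  induction n as [|n IH]; simpl.
  - unfold Cl1, C1; simpl; rewrite Rabs_R1, Rabs_R0; lra.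
  - apply Rle_trans with (1 := Cl1_mul _ _); apply Rmult_le_compat_l with (2 := IH).
    unfold Cl1; generalize (Rabs_pos (fst z)), (Rabs_pos (snd z)); lra.
Qed.

(** The real part of c e^(s w) for real s, so that the real Taylor formula applies. Differentiation
    in s only multiplies [c] by [w]. *)
Definition expline (w c : Cplx) (s : R) : R := fst (Cmul c (Cexp (s * fst w, s * snd w))).

Lemma is_derive_expline w c s : is_derive (expline w c) s (expline w (Cmul w c) s).
Proof.
  unfold expline, Cmul, Cexp; simpl; auto_derive; [exact I|ring].
Qed.

Lemma is_derive_n_expline w c n s :
  is_derive_n (expline w c) n s (expline w (Cmul (Cpow w n) c) s).
Proof.
  revert s; induction n as [|n IH]; intros s; simpl.
  - unfold expline, Cmul, C1; simpl; ring.
  - apply is_derive_ext with (expline w (Cmul (Cpow w n) c)).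
    + intros u; symmetry; apply is_derive_n_unique, IH.
    + replace (Cmul (Cmul w (Cpow w n)) c) with (Cmul w (Cmul (Cpow w n) c)).
      * apply is_derive_expline.
      * unfold Cmul; simpl; f_equal; ring.
Qed.

Lemma expline_bound w c s : 0 <= s <= 1 -> Rabs (expline w c s) <= Cl1 c * exp (Rabs (fst w)).
Proof.
  intros s01; unfold expline, Cmul, Cexp, Cl1; simpl.
  set (E := exp (s * fst w)).
  assert (E0 : 0 < E) by apply exp_pos.
  assert (EE : E <= exp (Rabs (fst w))).
  { assert (s * fst w <= Rabs (fst w)) as [lt|eq].
    { pose proof (Rle_abs (fst w)); pose proof (Rabs_pos (fst w)); nra. }
    - now apply Rlt_le, exp_increasing.
    - unfold E; rewrite eq; apply Rle_refl. }
  replace (fst c * (E * cos (s * snd w)) - snd c * (E * sin (s * snd w)))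
    with (E * (fst c * cos (s * snd w) + - (snd c * sin (s * snd w)))) by ring.
  rewrite Rabs_mult, (Rabs_pos_eq E), Rmult_comm by lra.
  apply Rmult_le_compat; [apply Rabs_pos|lra| |exact EE].
  apply Rle_trans with (1 := Rabs_triang _ _); rewrite Rabs_Ropp, !Rabs_mult.
  assert (Rabs (cos (s * snd w)) <= 1) by (apply Rabs_le, COS_bound).
  assert (Rabs (sin (s * snd w)) <= 1) by (apply Rabs_le, SIN_bound).
  pose proof (Rabs_pos (fst c)); pose proof (Rabs_pos (snd c)); nra.
Qed.

Lemma Cexp_taylor w c n :
  Rabs (fst (Cmul c (Cexp w)) - sum_f_R0 (fun k => fst (Cmul (Cpow w k) c) / INR (fact k)) n)
    <= Cl1 c * exp (Rabs (fst w)) * (Cl1 w ^ S n / INR (fact (S n))).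
Proof.
  destruct (Taylor_Lagrange (expline w c) n 0 1 Rlt_0_1) as [z [z01 Hz]].
  { intros s _ k _; destruct k as [|k]; [exact I|].
    exists (expline w (Cmul (Cpow w (S k)) c) s); exact (is_derive_n_expline w c (S k) s). }
  assert (at1 : expline w c 1 = fst (Cmul c (Cexp w))).
  { unfold expline; rewrite !Rmult_1_l; now destruct w. }
  rewrite <- at1, Hz, (is_derive_n_unique _ _ _ _ (is_derive_n_expline w c (S n) z)).
  rewrite (sum_eq _ (fun k => fst (Cmul (Cpow w k) c) / INR (fact k))).
  2: { intros k _; rewrite (is_derive_n_unique _ _ _ _ (is_derive_n_expline w c k 0)).
       rewrite Rminus_0_r, pow1; unfold expline, Cexp; simpl.
       rewrite !Rmult_0_l, exp_0, cos_0, sin_0; unfold Cmul, Rdiv; simpl; ring. }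
  match goal with |- Rabs (?a + ?b - ?c) <= _ => replace (a + b - c) with b by ring end.
  rewrite Rminus_0_r, pow1; unfold Rdiv; rewrite Rmult_1_l.
  pose proof (INR_fact_lt_0 (S n)) as f0; pose proof (Rinv_0_lt_compat _ f0) as if0.
  rewrite Rabs_mult, (Rabs_pos_eq (/ _)), <- Rmult_assoc, Rmult_comm by lra.
  apply Rmult_le_compat_r; [lra|].
  apply Rle_trans with (1 := expline_bound w (Cmul (Cpow w (S n)) c) z ltac:(lra)).
  replace (Cl1 c * exp (Rabs (fst w)) * Cl1 w ^ S n)
    with (Cl1 w ^ S n * Cl1 c * exp (Rabs (fst w))) by ring.
  apply Rmult_le_compat_r; [apply Rlt_le, exp_pos|].
  apply Rle_trans with (1 := Cl1_mul _ _); apply Rmult_le_compat_r with (2 := Cl1_pow _ _).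
  unfold Cl1; generalize (Rabs_pos (fst c)), (Rabs_pos (snd c)); lra.
Qed.

Lemma Cexp_series_cv w c eps : 0 < eps -> exists N, forall n, (N <= n)%nat ->
  Rabs (sum_f_R0 (fun k => fst (Cmul (Cpow w k) c) / INR (fact k)) n
    - fst (Cmul c (Cexp w))) <= eps.
Proof.
  intros eps0; set (B := Cl1 c * exp (Rabs (fst w)) + 1).
  assert (c0 : 0 <= Cl1 c) by (unfold Cl1; generalize (Rabs_pos (fst c)), (Rabs_pos (snd c)); lra).
  assert (B0 : 0 < B).
  { unfold B; pose proof (exp_pos (Rabs (fst w))); nra. }
  destruct (cv_speed_pow_fact (Cl1 w) (eps / B)) as [N HN].
  { now apply Rdiv_lt_0_compat. }
  exists N; intros n Nn; rewrite Rabs_minus_sym.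
  apply Rle_trans with (1 := Cexp_taylor w c n).
  specialize (HN (S n) ltac:(lia)); unfold R_dist in HN; rewrite Rminus_0_r in HN.
  set (x := Cl1 w ^ S n / INR (fact (S n))) in *.
  pose proof (Rle_abs x).
  assert (x * B < eps) by (apply Rlt_div_r; [exact B0|lra]).
  assert (0 <= x).
  { apply Rdiv_le_0_compat; [apply pow_le|apply INR_fact_lt_0].
    unfold Cl1; generalize (Rabs_pos (fst w)), (Rabs_pos (snd w)); lra. }
  unfold B in *; nra.
Qed.

Lemma Cexp_cv w eps : 0 < eps -> exists N, forall n, (N <= n)%nat ->
  Rabs (sum_f_R0 (fun k => fst (Cpow w k) / INR (fact k)) n - fst (Cexp w)) <= eps /\
  Rabs (sum_f_R0 (fun k => snd (Cpow w k) / INR (fact k)) n - snd (Cexp w)) <= eps.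
Proof.
  intros eps0.
  destruct (Cexp_series_cv w (1, 0) eps eps0) as [N1 H1].
  (* The factor [(0, -1)] is -i, and the real part of -i z is the imaginary part of z. *)
  destruct (Cexp_series_cv w (0, -1) eps eps0) as [N2 H2].
  exists (Nat.max N1 N2); intros n Nn; split.
  - rewrite (sum_eq _ (fun k => fst (Cmul (Cpow w k) (1, 0)) / INR (fact k))).
    + replace (fst (Cexp w)) with (fst (Cmul (1, 0) (Cexp w))); [apply H1; lia|simpl; ring].
    + intros k _; f_equal; simpl; ring.
  - rewrite (sum_eq _ (fun k => fst (Cmul (Cpow w k) (0, -1)) / INR (fact k))).
    + replace (snd (Cexp w)) with (fst (Cmul (0, -1) (Cexp w))); [apply H2; lia|simpl; ring].
    + intros k _; f_equal; simpl; ring.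
Qed.

Lemma sin_eq_0_unit x : x * x <= 1 -> sin x = 0 -> x = 0.
Proof.
  intros x1 sinx; pose proof PI2_1 as pi1.
  destruct (Rtotal_order x 0) as [lt|[eq|gt]]; [|assumption|].
  - assert (0 < sin (- x)) as pos by (apply sin_gt_0; nra).
    rewrite sin_neg in pos; lra.
  - assert (0 < sin x) as pos by (apply sin_gt_0; nra); lra.
Qed.

(** The imaginary part of e^(-t) is -e^(-Re t) sin(Im t). Since |Im t| <= 1 < pi, it vanishes only
    for Im t = 0, and then t e^(-t) is real. *)
Lemma Cexp_mul_opp_pos t : Cnorm2 t <= 1 -> snd (Cexp (Copp t)) = 0 ->
  snd (Cexp (Cmul t (Cexp (Copp t)))) = 0 /\ 0 < fst (Cexp (Cmul t (Cexp (Copp t)))).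
Proof.
  destruct t as [x y]; unfold Cnorm2; simpl; intros norm_le im0.
  assert (y = 0) as ->.
  { destruct (Rmult_integral _ _ im0) as [e0|siny].
    - pose proof (exp_pos (- x)); lra.
    - apply sin_eq_0_unit; [nra|]; rewrite sin_neg in siny; lra. }
  rewrite Ropp_0, sin_0, cos_0, !Rmult_0_r, !Rmult_0_l, Rplus_0_r, sin_0, cos_0.
  split; [ring|rewrite Rmult_1_r; apply exp_pos].
Qed.

From HB Require Import structures.
From mathcomp Require Import all_boot all_order all_algebra.
From mathcomp Require Import ring lra zify ssrZ.
From mathcomp Require Import perm archimedean mxtens.
Set Implicit Arguments.
Unset Strict Implicit.
Unset Printing Implicit Defensive.
Import Order.TTheory GRing.Theory Num.Theory.
From mathcomp Require Import Rstruct complex.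
Local Open Scope ring_scope.

(** * Weighted norms and eigenvalues of integer matrices *)

Section WeightedNorm.
Variable K : numDomainType.
Implicit Types (p q : {poly K}) (R x : K).

Definition wnorm R p : K := \sum_(i < size p) `|p`_i| * R ^+ i.

Lemma wnorm_wide R p n : (size p <= n)%N ->
  wnorm R p = \sum_(i < n) `|p`_i| * R ^+ i.
Proof.
move=> le_pn; rewrite /wnorm -!(big_mkord xpredT (fun i => `|p`_i| * R ^+ i)).
rewrite [RHS](big_cat_nat (leq0n _) le_pn) /= [X in _ = _ + X]big_nat_cond.
rewrite [X in _ = _ + X]big1 ?addr0 //.
by move=> i /andP[/andP[le_pi _] _]; rewrite nth_default // normr0 mul0r.
Qed.

Lemma wnorm_ge0 R p : 0 <= R -> 0 <= wnorm R p.
Proof. by move=> R0; apply: sumr_ge0 => i _; rewrite mulr_ge0 ?exprn_ge0. Qed.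

Lemma wnorm0 R : wnorm R 0 = 0.
Proof. by rewrite /wnorm size_poly0 big_ord0. Qed.

Lemma wnormC R c : wnorm R c%:P = `|c|.
Proof. by rewrite (wnorm_wide _ (size_polyC_leq1 c)) big_ord1 coefC mulr1. Qed.

Lemma wnormX R : wnorm R 'X = R.
Proof.
by rewrite (@wnorm_wide _ _ 2) ?size_polyX // !big_ord_recr big_ord0 /= !coefX
  normr0 normr1 mul0r add0r mul1r add0r.
Qed.

Lemma wnormD R p q : 0 <= R -> wnorm R (p + q) <= wnorm R p + wnorm R q.
Proof.
move=> R0; have := size_polyD p q; set m := maxn _ _ => sz.
rewrite (wnorm_wide _ sz) (@wnorm_wide _ p m) ?leq_maxl // (@wnorm_wide _ q m) ?leq_maxr //.
rewrite -big_split ler_sum // => i _ /=.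
by rewrite -mulrDl coefD ler_wpM2r ?exprn_ge0 ?ler_normD.
Qed.

Lemma wnormZ R c p : wnorm R (c *: p) = `|c| * wnorm R p.
Proof.
rewrite (wnorm_wide _ (size_scale_leq c p)) mulr_sumr; apply: eq_bigr => i _.
by rewrite coefZ normrM mulrA.
Qed.

Lemma wnormN R p : wnorm R (- p) = wnorm R p.
Proof. by rewrite -scaleN1r wnormZ normrN1 mul1r. Qed.

Lemma wnorm_sum R (I : Type) (r : seq I) (P : pred I) (F : I -> {poly K}) : 0 <= R ->
  wnorm R (\sum_(i <- r | P i) F i) <= \sum_(i <- r | P i) wnorm R (F i).
Proof.
move=> R0; elim/big_rec2: _ => [|i y x _ le]; first by rewrite wnorm0.
by rewrite (le_trans (wnormD _ _ R0)) ?lerD2l.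
Qed.

(** An equality, because the constant fills the slot freed by the shift. The bounds for products and
    for division by 'X - x both start from it. *)
Lemma wnorm_MXaddC R p c : wnorm R (p * 'X + c%:P) = R * wnorm R p + `|c|.
Proof.
have sz : (size (p * 'X + c%:P)%R <= (size p).+1)%N by rewrite size_MXaddC; case: ifP.
rewrite (wnorm_wide _ sz) big_ord_recl coefD coefMX coefC eqxx add0r mulr1 addrC.
congr (_ + _); rewrite mulr_sumr; apply: eq_bigr => i _.
by rewrite coefD coefMX coefC /= addr0 exprS mulrCA.
Qed.

Lemma wnorm_mulX R p : wnorm R (p * 'X) = R * wnorm R p.
Proof. by rewrite -[p * 'X]addr0 -polyC0 wnorm_MXaddC normr0 addr0. Qed.

Lemma wnormM R p q : 0 <= R -> wnorm R (p * q) <= wnorm R p * wnorm R q.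
Proof.
move=> R0; elim/poly_ind: p q => [|p c IHp] q; first by rewrite mul0r wnorm0 mul0r.
rewrite wnorm_MXaddC mulrDl mul_polyC mulrAC (le_trans (wnormD _ _ R0)) // wnorm_mulX wnormZ mulrDl.
by rewrite lerD2r -mulrA ler_wpM2l.
Qed.

Lemma wnorm_prod R (I : Type) (r : seq I) (P : pred I) (F : I -> {poly K}) : 0 <= R ->
  wnorm R (\prod_(i <- r | P i) F i) <= \prod_(i <- r | P i) wnorm R (F i).
Proof.
move=> R0; elim/big_rec2: _ => [|i y x _ le]; first by rewrite -polyC1 wnormC normr1.
by rewrite (le_trans (wnormM _ _ R0)) ?ler_wpM2l ?wnorm_ge0.
Qed.

Lemma norm_horner_le R p x : `|x| <= R -> `|p.[x]| <= wnorm R p.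
Proof.
move=> xR; rewrite horner_coef (le_trans (ler_norm_sum _ _ _)) // ler_sum // => i _.
by rewrite normrM normrX ler_wpM2l // lerXn2r ?nnegrE // (le_trans _ xR).
Qed.

End WeightedNorm.

Section MatrixNorm.
Variable K : numDomainType.

(** The entrywise sum, unlike the entrywise maximum, is submultiplicative. *)
Definition mxnorm m n (A : 'M[K]_(m, n)) : K := \sum_i \sum_j `|A i j|.

Lemma mxnorm_ge0 m n (A : 'M[K]_(m, n)) : 0 <= mxnorm A.
Proof. by do 2!apply: sumr_ge0 => ? _. Qed.

Lemma mxnorm_coef m n (A : 'M[K]_(m, n)) i j : `|A i j| <= mxnorm A.
Proof.
rewrite /mxnorm (bigD1 i) //= (bigD1 j) //= -addrA lerDl addr_ge0 ?sumr_ge0 // => *.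
by rewrite sumr_ge0.
Qed.

Lemma mxnorm0 m n : mxnorm (0 : 'M[K]_(m, n)) = 0.
Proof. by rewrite /mxnorm big1 // => i _; rewrite big1 // => j _; rewrite mxE normr0. Qed.

Lemma mxnormD m n (A B : 'M[K]_(m, n)) : mxnorm (A + B) <= mxnorm A + mxnorm B.
Proof.
rewrite -big_split ler_sum // => i _; rewrite -big_split ler_sum // => j _.
by rewrite mxE ler_normD.
Qed.

Lemma mxnormZ m n c (A : 'M[K]_(m, n)) : mxnorm (c *: A) = `|c| * mxnorm A.
Proof.
rewrite mulr_sumr; apply: eq_bigr => i _; rewrite mulr_sumr; apply: eq_bigr => j _.
by rewrite mxE normrM.
Qed.

Lemma mxnorm_sum m n (I : Type) (r : seq I) (P : pred I) (F : I -> 'M[K]_(m, n)) :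
  mxnorm (\sum_(i <- r | P i) F i) <= \sum_(i <- r | P i) mxnorm (F i).
Proof.
elim/big_rec2: _ => [|i y x _ le]; first by rewrite mxnorm0.
by rewrite (le_trans (mxnormD _ _)) ?lerD2l.
Qed.

Lemma mxnormM m n p (A : 'M[K]_(m, n)) (B : 'M[K]_(n, p)) :
  mxnorm (A *m B) <= mxnorm A * mxnorm B.
Proof.
rewrite mulr_suml ler_sum // => i _.
apply: (@le_trans _ _ (\sum_j \sum_k `|A i k| * `|B k j|)).
  apply: ler_sum => j _; rewrite mxE (le_trans (ler_norm_sum _ _ _)) // ler_sum // => k _.
  by rewrite normrM.
rewrite exchange_big mulr_suml ler_sum // => k _ /=; rewrite -mulr_sumr ler_wpM2l //.
by rewrite /mxnorm (bigD1 k) //= lerDl sumr_ge0 // => *; rewrite sumr_ge0.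
Qed.

Lemma mxnorm_scalar n (c : K) : mxnorm (c%:M : 'M_n) = n%:R * `|c|.
Proof.
rewrite /mxnorm -[in RHS](card_ord n) -sumr_const mulr_suml; apply: eq_bigr => i _.
rewrite (bigD1 i) //= mxE eqxx mulr1n big1 ?addr0 ?mul1r // => j /negPf ji.
by rewrite mxE eq_sym ji normr0.
Qed.

(** The factor [n%:R] is the norm of the identity matrix, the case [k = 0]. *)
Lemma mxnormX n (A : 'M[K]_n) (a : K) k :
  mxnorm A <= a -> mxnorm (A ^+ k) <= n%:R * a ^+ k.
Proof.
move=> Aa; elim: k => [|k IHk]; first by rewrite expr0 mxnorm_scalar normr1.
rewrite !exprS mulrCA (le_trans (mxnormM _ _)) // ler_pM ?mxnorm_ge0 //.
Qed.

End MatrixNorm.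

Lemma wnorm1_map_intr (C : numDomainType) (p : {poly int}) :
  wnorm 1 (map_poly intr p : {poly C}) = (wnorm 1 p)%:~R.
Proof.
rewrite /wnorm size_map_inj_poly ?rmorph0 //; last exact: intr_inj.
rewrite rmorph_sum; apply: eq_bigr => i _ /=.
by rewrite coef_map /= !expr1n !mulr1 intr_norm.
Qed.

(* After removing powers of 'X from p, the constant term is a nonzero integer. *)
Lemma norm_int_root_ge (C : numFieldType) (p : {poly int}) (z : C) :
  p != 0 -> z != 0 -> root (map_poly intr p) z -> 1 <= `|z| * (wnorm 1 p)%:~R.
Proof.
move=> p0 z0; elim/poly_ind: p p0 => [|p c IHp]; first by rewrite eqxx.
rewrite wnorm_MXaddC mul1r => pc0 rootz; have [c0|c0] := eqVneq c 0.
  move: pc0 rootz; rewrite c0 polyC0 addr0 normr0 addr0 rmorphM /= map_polyX rootM rootX (negPf z0).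
  rewrite orbF => pX0; apply: IHp; by apply: contraNneq pX0 => ->; rewrite mul0r.
have c1 : 1 <= `|c%:~R : C| by rewrite -intr_norm -[1]/(1%:~R) ler_int; lia.
have w0 : 0 <= (wnorm 1 p)%:~R :> C by rewrite ler0z wnorm_ge0.
(* For |z| > 1 it suffices that the norm is at least |c| >= 1. Otherwise |c| = |z| |p(z)|, and
   |p(z)| is at most [wnorm 1 p] on the unit disc. *)
rewrite intrD intr_norm; case: (real_leP (normr_real z) (real1 C)) => [z1|/ltW z1]; last first.
  by rewrite -{1}[1]mulr1 ler_pM // (le_trans c1) // lerDr.
rewrite (le_trans c1) // mulrDr (@le_trans _ _ (`|z| * (wnorm 1 p)%:~R)) ?lerDl ?mulr_ge0 //.
move: rootz; rewrite /root rmorphD rmorphM /= map_polyX map_polyC hornerMXaddC addrC addr_eq0.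
move=> /eqP ->; rewrite normrN normrM mulrC ler_wpM2l // -wnorm1_map_intr.
exact: norm_horner_le.
Qed.

(** A Liouville estimate without conjugates: z is a nonzero root of the characteristic polynomial,
    whose norm is at most D! (b + 1)^D, since each of the D! permutations contributes a product of D
    entries of norm at most b + 1. *)
Lemma norm_int_eigenvalue_ge (C : numFieldType) D (X : 'M[int]_D) (u : 'rV[C]_D) (z : C) b :
    mxnorm X <= b%:R -> u != 0 -> z != 0 -> u *m map_mx intr X = z *: u ->
  1 <= `|z| * (D`! * b.+1 ^ D)%:R.
Proof.
move=> Xb u0 z0 uX.
have : eigenvalue (map_mx intr X) z by apply/eigenvalueP; exists u.
rewrite eigenvalue_root_char -map_char_poly; set p := char_poly X => rootp.
have np : wnorm 1 p <= (D`! * b.+1 ^ D)%:R :> int.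
  rewrite (le_trans (wnorm_sum _ _ _ ler01)) //.
  have -> : (D`! * b.+1 ^ D)%:R = \sum_(s : 'S_D) (b.+1 ^ D)%:R :> int.
    by rewrite sumr_const card_Sn natrM mulr_natl.
  apply: ler_sum => s _; rewrite (le_trans (wnormM _ _ ler01)) //.
  rewrite -[(-1) ^+ s](rmorph_sign (@polyC _)) wnormC normrX normrN1 expr1n mul1r.
  rewrite (le_trans (wnorm_prod _ _ _ ler01)) //.
  have -> : (b.+1 ^ D)%:R = \prod_(i < D) b.+1%:R :> int by rewrite prodr_const card_ord natrX.
  apply: ler_prod => i _; rewrite wnorm_ge0 //= !mxE (le_trans (wnormD _ _ ler01)) //.
  rewrite wnormN wnormC -natr1 addrC lerD ?(le_trans (mxnorm_coef _ _ _)) //.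
  by case: eqP => _; rewrite ?mulr1n ?mulr0n ?wnormX ?wnorm0.
have p0 : p != 0 by rewrite monic_neq0 ?char_poly_monic.
have rz : root (map_poly intr p) z by [].
rewrite (le_trans (norm_int_root_ge p0 z0 rz)) // ler_wpM2l //.
by move: np; rewrite -(ler_int C) rmorph_nat.
Qed.

(** * Algebraic numbers as eigenvalues of integer matrices *)

Section IntegerEigenvectors.
Variable C : numFieldType.
Implicit Types (a b c z : C).

Definition algebraic z := exists2 p : {poly int}, p != 0 & root (map_poly intr p) z.

(** The matrix [A] represents the number [z] on [u]. With [u] fixed, sums and products of matrices
    represent sums and products of numbers, so integer matrices play the part of the integers of a
    number field. *)
Definition eigen n (u : 'rV[C]_n) (A : 'M[int]_n) z := u *m map_mx intr A = z *: u.

Lemma eigenD n (u : 'rV[C]_n) A B a b :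
  eigen u A a -> eigen u B b -> eigen u (A + B) (a + b).
Proof. by rewrite /eigen => uA uB; rewrite map_mxD mulmxDr uA uB scalerDl. Qed.

Lemma eigenM n (u : 'rV[C]_n) A B a b :
  eigen u A a -> eigen u B b -> eigen u (A *m B) (a * b).
Proof.
rewrite /eigen => uA uB.
by rewrite map_mxM mulmxA uA -scalemxAl uB scalerA.
Qed.

Lemma eigenZ n (u : 'rV[C]_n) A a (k : int) : eigen u A a -> eigen u (k *: A) (k%:~R * a).
Proof. by rewrite /eigen => uA; rewrite map_mxZ -scalemxAr uA scalerA. Qed.

Lemma eigen_scalar n (u : 'rV[C]_n) (k : int) : eigen u k%:M k%:~R.
Proof. by rewrite /eigen map_scalar_mx mul_mx_scalar. Qed.

Lemma eigenX n (u : 'rV[C]_n) A a k : eigen u A a -> eigen u (A ^+ k) (a ^+ k).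
Proof.
move=> uA; elim: k => [|k IHk]; last by rewrite !exprS; apply: eigenM.
exact: (eigen_scalar u 1).
Qed.

Lemma eigen_sum n (u : 'rV[C]_n) (I : Type) (r : seq I) (A : I -> 'M[int]_n) (a : I -> C) :
  (forall i, eigen u (A i) (a i)) -> eigen u (\sum_(i <- r) A i) (\sum_(i <- r) a i).
Proof.
move=> uA; elim/big_rec2: _ => [|i y x _]; last exact: eigenD.
by rewrite /eigen map_mx0 mulmx0 scale0r.
Qed.

Lemma algebraic_eigen z : algebraic z -> exists (q : int) n (A : 'M[int]_n) (u : 'rV[C]_n),
  [/\ q != 0, u != 0 & eigen u A (q%:~R * z)].
Proof.
move=> [p p0 rootz]; set q := lead_coef p.
have q0 : q != 0 by rewrite lead_coef_eq0.
have szp : (1 < size p)%N.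
  rewrite ltnNge; apply: contraTN rootz => /size1_polyC pE; move: p0; rewrite pE.
  by rewrite map_polyC rootC /= polyC_eq0 intr_eq0.
have [n szE] : exists n, size p = n.+2 by exists (size p).-2; case: (size p) szp => [|[]].
(* The companion matrix of p scaled by its leading coefficient q, acting on the row (1, z, ...,
   z^n). All columns but the last shift the powers of z; the last one expresses p(z) = 0. *)
exists q, n.+1, (\matrix_(i, j) if (j.+1 < n.+1)%N then q *+ (i == j.+1 :> nat) else - p`_i).
exists (\row_i z ^+ i); split => //.
  by apply/eqP => /rowP/(_ ord0)/eqP; rewrite !mxE expr0 oner_eq0.
apply/rowP => j; rewrite !mxE -mulrA -exprS; case: (ltnP j.+1 n.+1) => jn.
  rewrite (bigD1 (Ordinal jn)) //= !mxE /= jn eqxx mulr1n mulrC big1 ?addr0 // => i ij.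
  rewrite !mxE jn; rewrite (_ : (i == j.+1 :> nat) = false) ?mulr0 //.
  by apply: contraNF ij => /eqP ij; apply/eqP/val_inj.
have -> : j.+1 = n.+1 by apply/eqP; rewrite eqn_leq jn ltn_ord.
move: rootz; rewrite /root horner_coef size_map_inj_poly ?rmorph0 //; last exact: intr_inj.
rewrite szE big_ord_recr /= coef_map /= -[p`_n.+1]/(p`_(n.+2.-1)) -szE -/(lead_coef p) -/q.
rewrite addrC addr_eq0 => /eqP ->; rewrite -sumrN; apply: eq_bigr => i _.
by rewrite !mxE ltnNge jn coef_map /= rmorphN mulrN mulrC.
Qed.

Lemma tensmx_neq0 m n (u : 'rV[C]_m) (v : 'rV[C]_n) : u != 0 -> v != 0 -> u *t v != 0.
Proof.
move=> /rV0Pn[i ui] /rV0Pn[j vj].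
apply/eqP => /matrixP/(_ (mxtens_index (ord0, ord0)) (mxtens_index (i, j))).
by move/eqP; rewrite tensmxE mxE mulf_eq0 (negPf ui) (negPf vj).
Qed.

Lemma eigen_tensl m n (u : 'rV[C]_m) (v : 'rV[C]_n) A a :
  eigen u A a -> eigen (u *t v : 'rV_(m * n)) (A *t 1%:M) a.
Proof.
rewrite /eigen => uA; rewrite map_mxT map_mx1.
apply: etrans (tensmx_mul u v (map_mx intr A) 1%:M) _; rewrite uA mulmx1.
by apply/matrixP => i j; rewrite !mxE mulrA.
Qed.

Lemma eigen_tensr m n (u : 'rV[C]_m) (v : 'rV[C]_n) A a :
  eigen v A a -> eigen (u *t v : 'rV_(m * n)) (1%:M *t A) a.
Proof.
rewrite /eigen => vA; rewrite map_mxT map_mx1.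
apply: etrans (tensmx_mul u v 1%:M (map_mx intr A)) _; rewrite vA mulmx1.
by apply/matrixP => i j; rewrite !mxE mulrCA.
Qed.

(** The tensor product of three eigenvectors is a common eigenvector of matrices acting on one
    factor each. Each matrix is scaled by the leading coefficients of the other two, which yields
    the common denominator qa qb qc. *)
Lemma algebraic_common_eigen a b c : algebraic a -> algebraic b -> algebraic c ->
  exists (q : int) n (A B G : 'M[int]_n) (u : 'rV[C]_n), q != 0 /\ u != 0 /\
    [/\ eigen u A (q%:~R * a), eigen u B (q%:~R * b) & eigen u G (q%:~R * c)].
Proof.
move=> /algebraic_eigen[qa [l [A [u [qa0 u0 uA]]]]].
move=> /algebraic_eigen[qb [m [B [v [qb0 v0 vB]]]]].
move=> /algebraic_eigen[qc [n [G [w [qc0 w0 wG]]]]].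
exists (qa * qb * qc), (l * (m * n))%N.
exists ((qb * qc) *: (A *t 1%:M)), ((qa * qc) *: (1%:M *t (B *t 1%:M))).
exists ((qa * qb) *: (1%:M *t (1%:M *t G))), (u *t (v *t w)).
split; [by rewrite !mulf_neq0 | split; first by rewrite tensmx_neq0 // tensmx_neq0].
split; rewrite !rmorphM /=.
- have -> : qa%:~R * qb%:~R * qc%:~R * a = (qb * qc)%:~R * (qa%:~R * a).
    by rewrite rmorphM /=; ring.
  by apply/eigenZ/eigen_tensl.
- have -> : qa%:~R * qb%:~R * qc%:~R * b = (qa * qc)%:~R * (qb%:~R * b).
    by rewrite rmorphM /=; ring.
  by apply/eigenZ/eigen_tensr/eigen_tensl.
- have -> : qa%:~R * qb%:~R * qc%:~R * c = (qa * qb)%:~R * (qc%:~R * c).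
    by rewrite rmorphM /=; ring.
  by apply/eigenZ/eigen_tensr/eigen_tensr.
Qed.

End IntegerEigenvectors.

(** * Siegel's lemma *)

(* Pigeonhole: on the box [0, H]^I a linear form takes values in an interval of H ^ 2 + 1
   integers. *)
Lemma siegel (I J : finType) (a : J -> I -> int) (B : nat) :
    (0 < B)%N -> (0 < #|I|)%N -> (2 * #|J| <= #|I|)%N ->
    (forall j i, `|a j i| <= B%:R) ->
  exists c : I -> int, [/\ exists i, c i != 0,
    forall j, \sum_i a j i * c i = 0 & forall i, `|c i| <= (2 * #|I| * B)%:R].
Proof.
(* With this H the interval [-|I| B H, |I| B H] has length exactly H^2; [off] below shifts it to
   start at 0. *)
move=> B0 I0 JI aB; set H := (2 * #|I| * B)%N.
have val_le (x : {ffun I -> 'I_H.+1}) j : `|\sum_i a j i * (x i)%:R| <= (#|I| * B * H)%:R.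
  rewrite (le_trans (ler_norm_sum _ _ _)) // -mulnA natrM mulr_natl -[#|I|]/#|xpredT|.
  rewrite -sumr_const ler_sum // => i _; rewrite natrM normrM ler_pM // normr_nat ler_nat.
  by rewrite -ltnS.
pose off (x : {ffun I -> 'I_H.+1}) j := absz ((\sum_i a j i * (x i)%:R) + (#|I| * B * H)%:R).
have off_lt x j : (off x j < (H ^ 2).+1)%N.
  have := val_le x j; rewrite /off ltnS (_ : H ^ 2 = 2 * (#|I| * B * H))%N; last first.
    by rewrite expnS expn1 {1}/H -!mulnA.
  move: (\sum_i _) (_ * H)%N => y h; lia.
pose f x : {ffun J -> 'I_(H ^ 2).+1} := [ffun j => Ordinal (off_lt x j)].
have ninj : ~ injective f.
  move=> /leq_card; rewrite !card_ffun !card_ord leqNgt => /negP[].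
  have H0 : (0 < H)%N by rewrite !muln_gt0 I0 B0.
  (* For nonempty J, (H + 1)^|I| >= ((H + 1)^2)^|J| > (H^2 + 1)^|J|. The last step is not strict
     when J is empty, hence the separate case. *)
  have [J0|J0] := posnP #|J|; first by rewrite J0 expn0 -(exp1n #|I|) ltn_exp2r.
  by apply: leq_trans (leq_pexp2l _ JI) => //; rewrite expnM ltn_exp2r // !expnS !expn0; nia.
have [x [y [xy fxy]]] : exists x y, x != y /\ f x = f y.
  have /injectivePn[x [y xy fxy]] : ~~ injectiveb f by apply/injectiveP.
  by exists x, y.
exists (fun i => (x i)%:R - (y i)%:R); split.
- have /existsP[i xyi] : [exists i, x i != y i].
    apply: contraTT xy; rewrite negb_exists negbK => /forallP xy; apply/eqP/ffunP => i.
    by have := xy i; rewrite negbK => /eqP.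
  by exists i; rewrite subr_eq0 eqr_nat.
- move=> j; have /(congr1 (fun g : {ffun _ -> _} => val (g j))) := fxy; rewrite !ffunE /= /off.
  have := val_le x j; have := val_le y j.
  under [in X in _ -> _ -> _ -> X = _]eq_bigr do rewrite mulrBr.
  rewrite sumrB; move: (\sum_i _) (\sum_i _) (_ * H)%N => u v h; lia.
- by move=> i; have := ltn_ord (x i); have := ltn_ord (y i); lia.
Qed.

(** Vandermonde through interpolation: the vanishing power sums kill \sum_j c_j p(w_j) for every p
    of degree below |I|, in particular for the p that vanishes at all w_j except w_i. *)
Lemma power_sums_eq0 (C : fieldType) (I : finType) (c w : I -> C) : injective w ->
  (forall k, (k < #|I|)%N -> \sum_i c i * w i ^+ k = 0) -> forall i, c i = 0.
Proof.
move=> winj sum0 i; pose p := \prod_(j | j != i) ('X - (w j)%:P).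
have szp : size p = #|I|.
  rewrite /p -big_enum /= size_prod_XsubC -cardE (cardC1 i) prednK //.
  by apply/card_gt0P; exists i.
have : \sum_j c j * p.[w j] = 0.
  under eq_bigr do rewrite horner_coef szp mulr_sumr.
  rewrite exchange_big big1 //= => k _; under eq_bigr do rewrite mulrCA.
  by rewrite -mulr_sumr sum0 ?mulr0.
rewrite (bigD1 i) //= big1 ?addr0; last first.
  by move=> j ji; rewrite horner_prod (bigD1 j) //= hornerXsubC subrr mul0r mulr0.
move/eqP; rewrite mulf_eq0 => /orP[/eqP //|]; rewrite horner_prod => /prodf_eq0[j ji].
by rewrite hornerXsubC subr_eq0 => /eqP/winj/eqP; rewrite eq_sym (negPf ji).
Qed.

(** * A Schwarz lemma for polynomials with small jets *)

Section HermiteSchwarz.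
Variable C : numFieldType.
Implicit Types (p g : {poly C}) (x y R : C) (xs : seq C).

(** Dividing with remainder gives q 'X + p(x) = p + x q. The left side has norm at least R ||q||,
    the right side at most ||p|| + |x| ||q||. *)
Lemma wnorm_divXsubC R x p : 0 <= R ->
  (R - `|x|) * wnorm R (p %/ ('X - x%:P)) <= wnorm R p.
Proof.
move=> R0; set q := p %/ _; rewrite mulrBl lerBlDr.
have := divp_eq p ('X - x%:P); rewrite -/q modp_XsubC => pE.
have qE : q * 'X + p.[x]%:P = p + x *: q.
  by rewrite [in RHS]pE mulrBr [q * x%:P]mulrC mul_polyC addrAC subrK.
apply: (@le_trans _ _ (wnorm R (p + x *: q))); last by rewrite -wnormZ wnormD.
by rewrite -qE wnorm_MXaddC lerDl.
Qed.

Lemma wnorm_divXsubCn R x p s : 0 <= R -> `|x| <= R ->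
  (R - `|x|) ^+ s * wnorm R (p %/ ('X - x%:P) ^+ s) <= wnorm R p.
Proof.
move=> R0 xR; elim: s p => [|s IHs] p; first by rewrite !expr0 divp1 mul1r.
rewrite !exprS -divp_divl -mulrA; apply: le_trans (wnorm_divXsubC x p R0).
by rewrite ler_wpM2l ?subr_ge0.
Qed.

Definition nodepoly xs s : {poly C} := \prod_(x <- xs) ('X - x%:P) ^+ s.

Lemma nodepoly_monic xs s : nodepoly xs s \is monic.
Proof. by rewrite monic_prod // => x _; rewrite monic_exp ?monicXsubC. Qed.

Lemma wnorm_div_nodepoly R r xs s p : 0 <= r -> r <= R -> {in xs, forall x, `|x| <= r} ->
  (R - r) ^+ (s * size xs) * wnorm R (p %/ nodepoly xs s) <= wnorm R p.
Proof.
move=> r0 rR; have R0 := le_trans r0 rR; rewrite /nodepoly.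
elim: xs p => [|x xs IHxs] p xr; first by rewrite muln0 expr0 big_nil divp1 mul1r.
have xr' : `|x| <= r by rewrite xr ?mem_head.
rewrite big_cons -divp_divl /= mulnS exprD -mulrA.
apply: le_trans (wnorm_divXsubCn p s R0 (le_trans xr' rR)); apply: ler_pM.
- by rewrite exprn_ge0 // subr_ge0.
- by rewrite mulr_ge0 ?wnorm_ge0 ?exprn_ge0 // subr_ge0.
- by rewrite lerXn2r ?nnegrE ?subr_ge0 ?lerB // (le_trans xr').
- by apply: IHxs => z zxs; rewrite xr // inE zxs orbT.
Qed.

(** Induction with g general: the derivative of ('X - x)^(s+1) g is again ('X - x)^s times a
    polynomial, whose value at x is (s + 1) g(x). *)
Lemma derivn_XsubC_mul x g s :
  (('X - x%:P) ^+ s * g)^`(s).[x] = s`!%:R * g.[x].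
Proof.
elim: s g => [|s IHs] g; first by rewrite derivn0 expr0 !mul1r.
rewrite derivSn derivM deriv_exp derivXsubC mul1r /=.
have -> : ('X - x%:P) ^+ s *+ s.+1 * g + ('X - x%:P) ^+ s.+1 * g^`() =
    ('X - x%:P) ^+ s * (g *+ s.+1 + ('X - x%:P) * g^`()).
  by rewrite exprS mulrDr mulrnAl mulrnAr -mulrA [X in _ + X]mulrCA.
rewrite IHs hornerD hornerM hornerXsubC subrr mul0r addr0 hornerMn factS natrM.
by rewrite -[g.[x] *+ _]mulr_natl mulrCA mulrA.
Qed.

Lemma derivn_XsubC_mul0 x g s k : (k < s)%N -> (('X - x%:P) ^+ s * g)^`(k).[x] = 0.
Proof.
move=> ks; rewrite -(subnKC ks) addSnnS exprD -mulrA derivn_XsubC_mul.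
by rewrite hornerM horner_exp hornerXsubC subrr expr0n mul0r mulr0.
Qed.

Lemma dvdp_XsubC_derivn p x s :
  (forall k, (k < s)%N -> p^`(k).[x] = 0) -> ('X - x%:P) ^+ s %| p.
Proof.
elim: s => [|s IHs] jets; first by rewrite expr0 dvd1p.
have /dvdpP[g pE] : ('X - x%:P) ^+ s %| p by apply: IHs => k ks; apply: jets; rewrite ltnW.
have : root g x.
  have /eqP := jets s (ltnSn _); rewrite pE mulrC derivn_XsubC_mul mulf_eq0.
  by rewrite pnatr_eq0 -leqn0 leqNgt fact_gt0.
by rewrite -dvdp_XsubCl pE exprS => ?; rewrite dvdp_mul.
Qed.

Lemma dvdp_nodepoly xs s p : uniq xs ->
  {in xs, forall x k, (k < s)%N -> p^`(k).[x] = 0} -> nodepoly xs s %| p.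
Proof.
elim: xs => [|x xs IHxs] /=; first by rewrite /nodepoly big_nil dvd1p.
move=> /andP[xxs uxs] jets; rewrite /nodepoly big_cons Gauss_dvdp.
  rewrite dvdp_XsubC_derivn ?jets ?mem_head //=; last by apply: jets; rewrite mem_head.
  by apply: IHxs => // z zxs; apply: jets; rewrite inE zxs orbT.
rewrite coprimep_expl // coprimep_sym coprimep_XsubC /root horner_prod prodf_seq_eq0.
apply: contra xxs => /hasP[z zxs /=]; rewrite horner_exp hornerXsubC expf_eq0 subr_eq0.
by case/andP=> _ /eqP ->.
Qed.

Lemma derivn_nodepoly_mul xs s g x k : x \in xs -> (k < s)%N ->
  (g * nodepoly xs s)^`(k).[x] = 0.
Proof.
by move=> xxs ks; rewrite /nodepoly (big_rem x) //= mulrCA derivn_XsubC_mul0.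
Qed.

(** Hermite interpolation: the remainder depends linearly on the jets of p at the nodes. The
    constant is fixed before p, so it may be arbitrarily bad: it is only used with eps tending to
    0. *)
Lemma derivn_modp_bound xs s y : uniq xs -> exists2 B : C, 0 <= B &
  forall p (eps : C), 0 <= eps ->
    {in xs, forall x k, (k < s)%N -> `|p^`(k).[x]| <= eps} ->
  `|(p %% nodepoly xs s)^`(s).[y]| <= B * eps.
Proof.
move=> uxs; set W := nodepoly xs s; have W0 : W != 0 by rewrite monic_neq0 ?nodepoly_monic.
pose n := (size W).-1.
have szW : size W = n.+1 by rewrite prednK // size_poly_gt0.
have expand (q : {poly C}) k x : (size q <= n)%N ->
    q^`(k).[x] = \sum_(i < n) q`_i * ('X^i)^`(k).[x].
  move=> szq; have {1}-> : q = \poly_(i < n) q`_i.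
    by apply/polyP => i; rewrite coef_poly; case: ltnP => // ni;
      rewrite nth_default ?(leq_trans szq).
  rewrite poly_def linear_sum horner_sum; apply: eq_bigr => i _.
  by rewrite linearZ hornerZ.
(* Row i holds the jets of 'X^i; column j stands for the node of index j / s and the order j mod s.
   The matrix has a right inverse because a polynomial of degree below n with zero jets is divisible
   by W, hence zero. *)
pose J : 'M[C]_(n, size xs * s) :=
  \matrix_(i, j) ('X^i)^`(j %% s).[nth 0 xs (j %/ s)].
have [B JB] : exists B, J *m B = 1%:M.
  apply/row_freeP/inj_row_free => v vJ.
  pose q := rVpoly v.
  have szq : (size q <= n)%N by apply: size_poly.
  have Wq : W %| q.
    apply: dvdp_nodepoly => // x xxs k ks.
    have lt : (index x xs * s + k < size xs * s)%N.
      apply: (@leq_trans ((index x xs).+1 * s)); last by rewrite leq_mul2r index_mem xxs orbT.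
      by rewrite mulSn addnC ltn_add2r.
    have /rowP/(_ (Ordinal lt)) := vJ; rewrite [RHS]mxE => <-.
    rewrite expand // mxE; apply: eq_bigr => i _.
    rewrite coef_rVpoly_ord !mxE /= divnMDl ?(leq_ltn_trans _ ks) //.
    by rewrite divn_small // addn0 modnMDl modn_small // nth_index.
  have q0 : q = 0.
    apply/eqP; apply: contraTT szq => q0; rewrite -ltnNge -szW dvdp_leq //.
  by rewrite -[v]rVpolyK -/q q0 linear0.
pose d : 'cV[C]_n := \col_i ('X^i)^`(s).[y].
exists (\sum_j `|(B *m d) j 0|); first by rewrite sumr_ge0.
move=> p eps eps0 jets; set h := p %% W.
have szh : (size h <= n)%N by rewrite -ltnS -szW ltn_modp.
pose v : 'rV_n := poly_rV h.
have jetE (j : 'I_(size xs * s)) : (v *m J) 0 j = p^`(j %% s).[nth 0 xs (j %/ s)].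
  have s0 : (0 < s)%N by have := leq_ltn_trans (leq0n j) (ltn_ord j); rewrite muln_gt0 => /andP[].
  rewrite [in RHS](divp_eq p W) derivnD hornerD derivn_nodepoly_mul ?ltn_mod ?add0r //.
    by rewrite expand // mxE; apply: eq_bigr => i _; rewrite !mxE.
  by rewrite mem_nth // ltn_divLR.
have -> : h^`(s).[y] = (v *m J *m (B *m d)) 0 0.
  rewrite mulmxA -[v *m J *m B]mulmxA JB mulmx1 expand // mxE; apply: eq_bigr => i _.
  by rewrite !mxE.
rewrite mxE (le_trans (ler_norm_sum _ _ _)) // mulr_suml ler_sum // => j _.
rewrite normrM mulrC ler_wpM2l // jetE.
have s0 : (0 < s)%N by have := leq_ltn_trans (leq0n j) (ltn_ord j); rewrite muln_gt0 => /andP[].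
by apply: jets; rewrite ?ltn_mod // mem_nth // ltn_divLR.
Qed.

(* Schwarz' lemma for a function with small s-jets at the nodes; dividing by 'X - x
   shrinks wnorm R by R - |x|, which replaces the maximum modulus principle. *)
Lemma hermite_schwarz R r xs s y : uniq xs -> y \in xs -> 1 <= 2 * r -> r <= R ->
    {in xs, forall x, `|x| <= r} ->
  exists2 B : C, 0 <= B & forall p (eps : C), 0 <= eps ->
    {in xs, forall x k, (k < s)%N -> `|p^`(k).[x]| <= eps} ->
  (R - r) ^+ (s * size xs) * `|p^`(s).[y]| <=
    s`!%:R * (2 * r) ^+ (s * size xs) * wnorm R p + B * eps.
Proof.
move=> uxs yxs r1 rR xr; have r0 : 0 <= r by rewrite (le_trans _ (xr y yxs)).
have Rr0 : 0 <= (R - r) ^+ (s * size xs) by rewrite exprn_ge0 ?subr_ge0.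
have [B B0 HB] := derivn_modp_bound s y uxs.
exists ((R - r) ^+ (s * size xs) * B); first by rewrite mulr_ge0.
move=> p eps eps0 jets; set W := nodepoly xs s; set Q := p %/ W.
rewrite [in `|_|](divp_eq p W) derivnD hornerD.
apply: le_trans (ler_wpM2l Rr0 (ler_normD _ _)) _; rewrite mulrDr lerD //; last first.
  by rewrite -mulrA ler_wpM2l // HB.
(* W without its factor at y, so that the s-th derivative of Q W at y is s! Q(y) V(y). The missing
   factor is padded by (2 r)^s >= 1. *)
pose V : {poly C} := \prod_(x <- xs | x != y) ('X - x%:P) ^+ s.
have WE : W = ('X - y%:P) ^+ s * V by rewrite /W /nodepoly (bigD1_seq y).
rewrite -/Q WE mulrCA derivn_XsubC_mul hornerM !normrM normr_nat.
have VB : `|V.[y]| <= (2 * r) ^+ (s * size xs).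
  have -> : (2 * r) ^+ (s * size xs) = \prod_(x <- xs) (2 * r) ^+ s.
    by elim: (xs) => [|x l IHl]; rewrite ?muln0 ?big_nil // big_cons -IHl mulnS exprD.
  rewrite /V horner_prod normr_prod big_mkcond /= [leLHS]big_seq [leRHS]big_seq.
  apply: ler_prod => x xxs.
  case: ifP => _; last by rewrite ler01 exprn_ege1.
  rewrite normr_ge0 horner_exp normrX hornerXsubC lerXn2r ?nnegrE ?(le_trans ler01 r1) //.
  by rewrite mulr_natl mulr2n (le_trans (ler_normB _ _)) // lerD ?xr.
have QB : (R - r) ^+ (s * size xs) * `|Q.[y]| <= wnorm R p.
  apply: le_trans (wnorm_div_nodepoly s p r0 rR xr); rewrite ler_wpM2l //.
  by rewrite norm_horner_le // (le_trans (xr y yxs)).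
rewrite mulrCA -!mulrA ler_wpM2l // mulrA [leRHS]mulrC; apply: ler_pM => //.
exact: mulr_ge0.
Qed.

End HermiteSchwarz.

(** * The Gelfond-Schneider theorem *)

Section NatEstimates.
Local Open Scope nat_scope.

Lemma fact_le_expn n : n`! <= n ^ n.
Proof.
suff: forall k, k <= n -> k`! <= n ^ k by apply.
by elim=> // k IHk kn; rewrite factS expnS leq_mul // IHk // ltnW.
Qed.

(* With N = E r and n = E r ^ 2, every factor on the right is at most
   K ^ s * s ^ (k s) for a K independent of r, and the exponents k add up to D + 2,
   whereas r ^ (s M) >= (s / E ^ 2) ^ ((D + 3) s). *)
Lemma gelfond_parameters D b tau Ke b0 M E :
    0 < b -> 0 < tau -> 0 < Ke -> 0 < E -> M = 2 * (D + 3) ->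
  exists2 r, 0 < r & forall s N n (P := fun k => b ^ 3 * b ^ (2 * N * M) * (2 * N * b) ^ k)
      (H := 2 * (N * N) * P n),
    N = E * r -> n = E * (r * r) -> n <= s < N * N ->
  b ^ (s + 2 * N * M) * (D`! * (N * N * (H * P s)).+1 ^ D) *
    (tau ^ s * (s`! * (2 * M) ^ (s * M) * (N * N * H * Ke ^ (b0 * N * (r + M))))) < r ^ (s * M).
Proof.
move=> b_gt0 tau_gt0 Ke_gt0 E_gt0 ME.
pose K1 := 2 * E * E * 4 * b ^ (6 + 4 * M) * (4 * b * b * E).
have K1_gt0 : 0 < K1.
  have : 0 < b ^ (6 + 4 * M) by rewrite expn_gt0 b_gt0.
  by rewrite /K1; move: (b ^ _) => z z_gt0; rewrite !muln_gt0 b_gt0 E_gt0 z_gt0.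
pose L := b ^ (1 + 2 * M) * (D`! * (2 * K1) ^ D) * (tau * ((2 * M) ^ M * K1 * Ke ^ (2 * b0))).
(* Being at least M gives N (r + M) <= 2 s; exceeding E^M L contradicts the final comparison. *)
exists (E ^ M * L + M + 1); first by rewrite addn1.
set r := _ + 1 => s N n P H NE nE /andP[ns sN].
have r_gt0 : 0 < r by rewrite /r addn1.
have Mr : M <= r by rewrite /r -addnA addnCA leq_addr.
have Lr : E ^ M * L < r by rewrite /r addn1 ltnS leq_addr.
clearbody r.
have rn : r <= n by rewrite nE mulnA leq_pmull // muln_gt0 E_gt0.
have rs : r <= s by rewrite (leq_trans rn).
have s_gt0 : 0 < s by rewrite (leq_trans r_gt0).
have M_gt0 : 0 < M by rewrite ME muln_gt0 addn3.
have Nn : N <= n by rewrite NE nE leq_mul2l leq_pmulr ?orbT.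
have Ns : N <= s by rewrite (leq_trans Nn).
have NNE : N * N = E * n by rewrite NE nE; ring.
have NNs : N * N <= E * s by rewrite NNE leq_mul2l ns orbT.
have Nrs : N * r <= s by rewrite NE -mulnA -nE.
have NrM : N * (r + M) <= 2 * s.
  by rewrite mulnDr mul2n -addnn leq_add // (leq_trans _ Nrs) // leq_mul2l Mr orbT.
have N_gt0 : 0 < N by rewrite NE muln_gt0 E_gt0.
have Nb : 0 < 2 * N * b by rewrite !muln_gt0 N_gt0.
have b2 : b ^ (2 * N * M) <= (b ^ (2 * M)) ^ s.
  by rewrite -expnM leq_pexp2l // -mulnA [N * M]mulnC mulnA leq_mul2l Ns orbT.
have leKs a : 0 < a -> a <= a ^ s by move=> a0; rewrite -{1}[a]expn1 leq_pexp2l.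
have s2 : s <= 2 ^ s by rewrite ltnW // ltn_expl.
have YK : N * N * (H * P s) <= K1 ^ s * s ^ (1 * s).
  have -> : N * N * (H * P s) =
      2 * (N * N) * (N * N) * (b ^ 6 * (b ^ (2 * N * M) * b ^ (2 * N * M))) *
      ((2 * N * b) ^ n * (2 * N * b) ^ s).
    by rewrite /H /P; move: (b ^ (2 * N * M)) ((2 * N * b) ^ n) (_ ^ s) => x y z; ring.
  have -> : K1 ^ s * s ^ (1 * s) =
      (2 * E * E * 4) ^ s * (b ^ (6 + 4 * M)) ^ s * ((4 * b * b * E) ^ s * s ^ s).
    by rewrite mul1n /K1 !expnMn !mulnA.
  apply: leq_mul; first apply: leq_mul.
  - apply: (@leq_trans (2 * (E * s) * (E * s))); first by rewrite leq_mul // leq_mul.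
    rewrite (_ : 2 * (E * s) * (E * s) = 2 * E * E * (s * s)); last by ring.
    rewrite expnMn leq_mul //; first by rewrite leKs // !muln_gt0 E_gt0.
    by rewrite (_ : 4 = 2 * 2) // expnMn leq_mul.
  - rewrite expnD expnMn leq_mul //; first by rewrite leKs // expn_gt0 b_gt0.
    by rewrite (mulnDl 2 2 M) expnD expnMn leq_mul.
  - rewrite -expnMn; apply: (@leq_trans ((2 * N * b) ^ s * (2 * N * b) ^ s)).
      by rewrite leq_mul // leq_pexp2l.
    rewrite -expnMn leq_exp2r // (_ : 2 * N * b * (2 * N * b) = 4 * b * b * (N * N)); last by ring.
    by rewrite -[leqRHS]mulnA leq_mul.
have HY : N * N * H <= N * N * (H * P s).
  by rewrite mulnA leq_pmulr // /P !muln_gt0 !expn_gt0 b_gt0 Nb.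
set Y := N * N * (H * P s) in YK HY *.
have Y1 : Y.+1 ^ D <= ((2 * K1) ^ D) ^ s * s ^ (D * s).
  have -> : ((2 * K1) ^ D) ^ s * s ^ (D * s) = ((2 * K1) ^ s * s ^ s) ^ D.
    by rewrite [RHS]expnMn -!expnM [D * s]mulnC.
  have [->|D_gt0] := posnP D; first by rewrite !expn0.
  rewrite leq_exp2r // expnMn -mulnA -[s in s ^ s]mul1n.
  rewrite mul1n in YK; have Z_gt0 : 0 < K1 ^ s * s ^ s.
    by rewrite muln_gt0 !expn_gt0 K1_gt0 s_gt0.
  apply: (@leq_trans (2 * (K1 ^ s * s ^ s))); first by rewrite mul2n -addnn -addn1 leq_add.
  by rewrite ?mul1n leq_mul // leKs.
clearbody K1; rewrite ltnNge; apply/negP => le_r.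
(* The exponent D + 2 of s^s collects D from the eigenvalue bound, one from s! and one from the size
   of the coefficients. *)
have RL : r ^ (s * M) <= L ^ s * s ^ ((D + 2) * s).
  apply: (leq_trans le_r).
  have -> : L ^ s * s ^ ((D + 2) * s) =
    (b ^ (1 + 2 * M)) ^ s * (D`! ^ s * (((2 * K1) ^ D) ^ s * s ^ (D * s))) *
    (tau ^ s * (s ^ s * (2 * M) ^ (s * M) * (K1 ^ s * s ^ (1 * s) * Ke ^ (2 * b0 * s)))).
    rewrite /L mul1n (mulnDl D 2 s) mul2n -addnn !(expnD s) [s * M]mulnC !(expnM _ _ s).
    move: (b ^ _) (_ ^ D) (_ ^ M) (Ke ^ _) (s ^ _) (s ^ s) => x1 x2 x3 x4 y z.
    rewrite !expnMn; move: (_ ^ s) (_ ^ s) (_ ^ s) (_ ^ s) (_ ^ s) (_ ^ s) (_ ^ s).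
    by move=> *; ring.
  apply: leq_mul; first apply: leq_mul.
  - by rewrite expnD expnD !expnMn expn1 leq_mul // -expnM.
  - by rewrite leq_mul // leKs // fact_gt0.
  - apply: leq_mul => //; apply: leq_mul; first by rewrite leq_mul ?fact_le_expn.
    rewrite leq_mul ?(leq_trans HY) // leq_pexp2l //.
    by rewrite [2 * b0]mulnC -!mulnA leq_mul2l NrM orbT.
(* Here s < N^2 = E^2 r^2 and M = 2 (D + 3) turn s^((D + 3) s) into at most (E^M)^s r^(s M).
   Cancelling s^((D + 2) s) leaves s <= E^M L < r, against r <= s. *)
have : s ^ ((D + 3) * s) <= (E ^ M * L) ^ s * s ^ ((D + 2) * s).
  have sE : s <= E * E * (r * r) by rewrite (leq_trans (ltnW sN)) // NE mulnACA.
  apply: (@leq_trans ((E * E * (r * r)) ^ ((D + 3) * s))).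
    by rewrite leq_exp2r // muln_gt0 addn3.
  rewrite expnMn [(E ^ M * L) ^ s]expnMn -mulnA leq_mul //.
    by rewrite !mulnn -!expnM ME mulnA.
  by rewrite mulnn -expnM mulnA -ME mulnC.
rewrite addnS mulSn expnD leq_pmul2r ?expn_gt0 ?s_gt0 // leq_exp2r // => le_s.
by move: Lr; rewrite ltnNge (leq_trans rs).
Qed.
End NatEstimates.

Section GelfondTerms.
Variable C : numFieldType.
Variables (D N : nat) (q : int) (A B G : 'M[int]_D).

(** The leading power of q pads the denominators: every p needs the same total power
    [k + 2 * N * m], so integer combinations of these matrices represent combinations of the
    terms. *)
Definition gelfond_term (k m : nat) (p : 'I_N * 'I_N) : 'M[int]_D :=
  q ^+ ((N - p.1) * m + (N - p.2) * m) *: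
    ((p.1%:R *: q%:M + p.2%:R *: B) ^+ k *m (A ^+ (p.1 * m) *m G ^+ (p.2 * m))).

Lemma gelfond_term_eigen (u : 'rV[C]_D) (al be ga : C) k m p :
    eigen u A (q%:~R * al) -> eigen u B (q%:~R * be) -> eigen u G (q%:~R * ga) ->
  eigen u (gelfond_term k m p) (q%:~R ^+ (k + 2 * N * m) *
    ((p.1%:R + p.2%:R * be) ^+ k * (al ^+ (p.1 * m) * ga ^+ (p.2 * m)))).
Proof.
move=> uA uB uG; case: p => i j /=.
have -> : q%:~R ^+ (k + 2 * N * m) * ((i%:R + j%:R * be) ^+ k * (al ^+ (i * m) * ga ^+ (j * m))) =
    (q ^+ ((N - i) * m + (N - j) * m))%:~R * ((i%:R%:~R * q%:~R + j%:R%:~R * (q%:~R * be)) ^+ k *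
      ((q%:~R * al) ^+ (i * m) * (q%:~R * ga) ^+ (j * m))) :> C.
  rewrite !rmorph_nat rmorphXn /= (_ : i%:R * _ + _ = q%:~R * (i%:R + j%:R * be)); last by ring.
  have -> : (k + 2 * N * m = k + (i * m + j * m + ((N - i) * m + (N - j) * m)))%N.
    have := ltn_ord i; have := ltn_ord j; nia.
  by rewrite !exprMn !exprD; ring.
apply: eigenZ; apply: eigenM; last by apply: eigenM; apply: eigenX.
by apply/eigenX/eigenD; apply: eigenZ => //; apply: eigen_scalar.
Qed.

(** Each of the three matrix powers costs a factor D <= b, hence b^3. The exponents of q, A and G
    add up to 2 N m, and the base of the k-th power is a sum of two terms of norm at most N b. *)
Lemma gelfond_term_norm (b : nat) k m p M : (0 < b)%N -> (D <= b)%N -> `|q| <= b%:R ->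
    mxnorm A <= b%:R -> mxnorm B <= b%:R -> mxnorm G <= b%:R -> mxnorm (q%:M : 'M_D) <= b%:R ->
    (m <= M)%N ->
  mxnorm (gelfond_term k m p) <= (b ^ 3 * b ^ (2 * N * M) * (2 * N * b) ^ k)%:R.
Proof.
move=> b0 Db qb Ab Bb Gb qMb mM; case: p => i j.
have le_natM (x y : int) (a c : nat) : 0 <= x -> 0 <= y -> x <= a%:R -> y <= c%:R ->
    x * y <= (a * c)%:R by move=> *; rewrite natrM ler_pM.
have le_natX (x : int) (a n : nat) : 0 <= x -> x <= a%:R -> x ^+ n <= (a ^ n)%:R.
  by move=> x0 xa; rewrite natrX lerXn2r ?nnegrE // (le_trans x0).
have powb (X : 'M[int]_D) (a n : nat) : mxnorm X <= a%:R -> mxnorm (X ^+ n) <= (b * a ^ n)%:R.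
  by move=> /(mxnormX n)/le_trans; apply; rewrite -natrX -natrM ler_nat leq_mul2r Db orbT.
rewrite /gelfond_term mxnormZ normrX /=.
apply: (@le_trans _ _ (b ^ ((N - i) * m + (N - j) * m) * ((b * (2 * N * b) ^ k) *
   ((b * b ^ (i * m)) * (b * b ^ (j * m)))))%:R).
  rewrite le_natM ?exprn_ge0 ?mxnorm_ge0 ?le_natX //.
  rewrite (le_trans (mxnormM _ _)) // le_natM ?mxnorm_ge0 //; last first.
    by rewrite (le_trans (mxnormM _ _)) // le_natM ?mxnorm_ge0 ?powb.
  rewrite powb // (le_trans (mxnormD _ _)) // !mxnormZ !normr_nat.
  rewrite -mulnA mul2n -addnn natrD lerD // natrM ler_pM ?mxnorm_ge0 // ler_nat ltnW //.
rewrite ler_nat (_ : (_ * (_ * _) = b ^ 3 * b ^ ((N - i) * m + (N - j) * m + (i * m + j * m)) *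
  (2 * N * b) ^ k)%N); last by rewrite [in RHS]expnD (expnD b (i * m)); ring.
rewrite leq_mul2r leq_mul2l leq_pexp2l ?orbT //.
rewrite (_ : _ + _ = 2 * N * m)%N ?leq_mul2l ?mM ?orbT //.
by have := ltn_ord i; have := ltn_ord j; nia.
Qed.

End GelfondTerms.

(** * Exponential sums for an additive-to-multiplicative [e] that is the limit of its Taylor
    polynomials *)

Section ExponentialSums.
Variables (C : numFieldType) (e : C -> C).
Implicit Types (w x y R : C) (T k s : nat).

Definition exp_poly w T : {poly C} := \poly_(k < T) (w ^+ k / k`!%:R).

Hypothesis archC : forall x : C, exists n : nat, `|x| <= n%:R.
Hypothesis expD : forall x y, e (x + y) = e x * e y.
Hypothesis exp_lim : forall w (eps : C), 0 < eps -> exists T0, forall T, (T0 <= T)%N ->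
  `|(exp_poly w T).[1] - e w| <= eps.

Lemma exp_polyE w T x : (exp_poly w T).[x] = \sum_(k < T) (w * x) ^+ k / k`!%:R.
Proof. by rewrite horner_poly; apply: eq_bigr => k _; rewrite exprMn mulrAC. Qed.

Lemma exp_lim_at w x (eps : C) : 0 < eps -> exists T0, forall T, (T0 <= T)%N ->
  `|(exp_poly w T).[x] - e (w * x)| <= eps.
Proof.
move=> /(exp_lim (w * x))[T0 lim]; exists T0 => T /lim.
by rewrite !exp_polyE mulr1.
Qed.

(** Passage to the limit in estimates for Taylor polynomials; a > b would be refuted by eps = (a -
    b) / (B + 1). *)
Lemma le_of_le_eps (a b B : C) : 0 <= a -> 0 <= b -> 0 <= B ->
  (forall eps, 0 < eps -> a <= b + B * eps) -> a <= b.
Proof.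
move=> a0 b0 B0 le; case: (real_leP (ger0_real a0) (ger0_real b0)) => // lt.
pose d := (a - b) / (B + 1); have d0 : 0 < d by rewrite divr_gt0 ?subr_gt0 // ltr_wpDl.
have := le d d0; rewrite -lerBlDl => le1.
have : a - b < a - b.
  rewrite {2}(_ : a - b = (B + 1) * d); last by rewrite mulrC divfK // gt_eqF // ltr_wpDl.
  by rewrite (le_lt_trans le1) // mulrDl mul1r ltrDl.
by rewrite ltxx.
Qed.

Lemma exp0 : e 0 = 1.
Proof.
apply/eqP; rewrite -subr_eq0 -normr_le0 distrC; apply: (@le_of_le_eps _ _ 1) => // eps eps0.
rewrite add0r mul1r; have [T0 /(_ T0.+1 (leqnSn _))] := exp_lim 0 eps0.
rewrite exp_polyE big_ord_recl expr0 divr1 big1 ?addr0 // => i _.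
by rewrite !mul0r expr0n mul0r.
Qed.

Lemma expX x n : e (x * n%:R) = e x ^+ n.
Proof.
elim: n => [|n IHn]; first by rewrite mulr0 exp0.
by rewrite -natr1 mulrDr mulr1 expD IHn exprSr.
Qed.

Lemma wnorm_exp_poly w T R n : 0 <= R -> `|w| * R <= n%:R ->
  wnorm R (exp_poly w T) <= \sum_(k < T) n%:R ^+ k / k`!%:R.
Proof.
move=> R0 le_n; rewrite (wnorm_wide _ (size_poly _ _)); apply: ler_sum => k _.
rewrite coef_poly ltn_ord normrM normfV normr_nat normrX mulrAC -exprMn.
by rewrite ler_wpM2r ?invr_ge0 // lerXn2r ?nnegrE ?mulr_ge0.
Qed.

(** The partial sums have nonnegative terms, so they stay below their limit e(n) = e(1)^n. *)
Lemma exp_sum_bound : exists2 K : nat, (0 < K)%N &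
  forall n T, \sum_(k < T) n%:R ^+ k / k`!%:R <= (K ^ n)%:R :> C.
Proof.
have [K eK] := archC (e 1); exists K.+1 => // n T.
apply: (@le_of_le_eps _ _ 1) => //; first by apply: sumr_ge0 => k _; rewrite divr_ge0 ?exprn_ge0.
move=> eps /(exp_lim n%:R)[T0 /(_ _ (leq_maxr T T0))]; set T1 := maxn T T0 => lim.
apply: (@le_trans _ _ `|(exp_poly n%:R T1).[1]|).
  rewrite exp_polyE mulr1 ger0_norm; last by apply: sumr_ge0 => k _; rewrite divr_ge0 ?exprn_ge0.
  rewrite -!(big_mkord xpredT (fun k => n%:R ^+ k / k`!%:R)).
  rewrite [leRHS](@big_cat_nat _ _ _ T) ?leq_maxl //= lerDl sumr_ge0 // => k _.
  by rewrite divr_ge0 ?exprn_ge0.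
rewrite -[X in `|X|](subrK (e n%:R)) (le_trans (ler_normD _ _)) // addrC mul1r lerD //.
rewrite -[n%:R]mul1r expX normrX natrX lerXn2r ?nnegrE // (le_trans eK) // ler_nat //.
Qed.

Lemma deriv_exp_poly w T : (exp_poly w T.+1)^`() = w *: exp_poly w T.
Proof.
apply/polyP => i; rewrite coef_deriv coefZ !coef_poly ltnS; case: ifP => _; last first.
  by rewrite mulr0 mul0rn.
rewrite factS natrM exprS -[LHS]mulr_natr.
have : i.+1%:R != 0 :> C by rewrite pnatr_eq0.
have : i`!%:R != 0 :> C by rewrite pnatr_eq0 -lt0n fact_gt0.
by move: (i.+1%:R) (i`!%:R) => a b b0 a0; field; rewrite a0 b0.
Qed.

Lemma derivn_exp_poly w T k : (exp_poly w (k + T))^`(k) = w ^+ k *: exp_poly w T.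
Proof.
elim: k => [|k IHk]; first by rewrite derivn0 expr0 scale1r.
rewrite derivSn addSn deriv_exp_poly linearZ /= IHk scalerA -exprS //.
Qed.

Section Family.
Variables (I : finType) (c w : I -> C).

(** The k-th derivative at x of \sum_i c_i e^(w_i z), given by its closed form. *)
Definition exp_jet k x := \sum_i c i * w i ^+ k * e (w i * x).

Let P T := \sum_i c i *: exp_poly (w i) T.

Let jet_lim k x (eps : C) : 0 < eps -> exists T0, forall T, (T0 <= T)%N ->
  `|(P T)^`(k).[x] - exp_jet k x| <= eps.
Proof.
move=> eps0; pose S := \sum_i `|c i * w i ^+ k|.
have S0 : 0 <= S by apply: sumr_ge0.
have d0 : 0 < eps / (S + 1) by rewrite divr_gt0 // ltr_wpDl.
have [T0 lim] := fin_all_exists (fun i => exp_lim_at (w i) x d0).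
(* Differentiating k times removes k terms of each Taylor polynomial, so T must exceed the
   thresholds by k. *)
exists (k + \max_i T0 i)%N => T leT.
have -> : (P T)^`(k).[x] - exp_jet k x =
    \sum_i c i * w i ^+ k * ((exp_poly (w i) (T - k)).[x] - e (w i * x)).
  rewrite linear_sum horner_sum -sumrB; apply: eq_bigr => i _.
  rewrite linearZ -{1}(subnKC (leq_trans (leq_addr _ _) leT)) /= derivn_exp_poly.
  by rewrite !hornerZ mulrBr mulrA.
apply: (@le_trans _ _ (S * (eps / (S + 1)))).
  rewrite (le_trans (ler_norm_sum _ _ _)) // mulr_suml ler_sum // => i _.
  rewrite normrM ler_wpM2l // lim // leq_subRL ?(leq_trans _ leT) //.
    by rewrite leq_add2l leq_bigmax.
  exact: leq_addr.
by rewrite mulrA ler_pdivrMr ?ltr_wpDl // mulrC ler_wpM2l ?ltW // ltrDl.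
Qed.

(* The exponential sum is handled through its Taylor polynomials P T, whose jets at the
   nodes tend to 0. *)
Lemma exp_jet_bound (xs : seq C) s y R r (n K : nat) :
    (forall n T, \sum_(k < T) n%:R ^+ k / k`!%:R <= (K ^ n)%:R :> C) ->
    uniq xs -> y \in xs -> 1 <= 2 * r -> r <= R -> {in xs, forall x, `|x| <= r} ->
    (forall i, `|w i| * R <= n%:R) ->
    {in xs, forall x k, (k < s)%N -> exp_jet k x = 0} ->
  (R - r) ^+ (s * size xs) * `|exp_jet s y| <=
    s`!%:R * (2 * r) ^+ (s * size xs) * ((\sum_i `|c i|) * (K ^ n)%:R).
Proof.
move=> boundK uxs yxs r1 rR xr wn jet0.
have r0 : 0 <= r by rewrite (le_trans _ (xr y yxs)).
have R0 := le_trans r0 rR.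
have rR0 : 0 <= (R - r) ^+ (s * size xs) by rewrite exprn_ge0 ?subr_ge0.
have [B B0 HB] := hermite_schwarz s uxs yxs r1 rR xr.
(* Two errors are linear in eps: B from the jets at the nodes, and the power of R - r from replacing
   the exponential sum by P T at y. *)
apply: (@le_of_le_eps _ _ (B + (R - r) ^+ (s * size xs))); rewrite ?mulr_ge0 ?addr_ge0 //.
- by rewrite exprn_ge0 // (le_trans ler01).
- by rewrite sumr_ge0.
move=> eps eps0.
have [T0 lim0] : exists T0, forall T, (T0 <= T)%N ->
    {in xs, forall x k, (k < s)%N -> `|(P T)^`(k).[x]| <= eps}.
  have [T0 lim0] := fin_all_exists (fun jk : 'I_(size xs) * 'I_s =>
    jet_lim jk.2 (nth 0 xs jk.1) eps0).
  exists (\max_jk T0 jk) => T leT x xxs k ks.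
  have lt : (index x xs < size xs)%N by rewrite index_mem.
  have := lim0 (Ordinal lt, Ordinal ks) T; rewrite /= nth_index // jet0 // subr0; apply.
  by rewrite (leq_trans _ leT) // (leq_bigmax (Ordinal lt, Ordinal ks)).
have [T1 lim1] := jet_lim s y eps0.
set T := maxn T0 T1; have := HB (P T) eps (ltW eps0) (lim0 T (leq_maxl _ _)).
have PT : wnorm R (P T) <= (\sum_i `|c i|) * (K ^ n)%:R.
  rewrite (le_trans (wnorm_sum _ _ _ R0)) // mulr_suml ler_sum // => i _.
  by rewrite wnormZ ler_wpM2l // (le_trans (wnorm_exp_poly _ R0 (wn i))).
move=> HT; have jetT : `|exp_jet s y| <= `|(P T)^`(s).[y]| + eps.
  rewrite -[exp_jet s y](subrK (P T)^`(s).[y]) addrC (le_trans (ler_normD _ _)) // lerD2l.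
  by rewrite distrC lim1 // leq_maxr.
apply: (le_trans (ler_wpM2l rR0 jetT)); rewrite mulrDr [(B + _) * _]mulrDl addrA lerD2r.
apply: (le_trans HT); rewrite lerD2r ler_wpM2l // mulr_ge0 // exprn_ge0 // (le_trans ler01) //.
Qed.

End Family.

Section GelfondSchneider.
Variables t be : C.
Hypothesis t_neq0 : t != 0.
Hypothesis be_irrational : forall a b : int, a%:~R + b%:~R * be = 0 -> b = 0.

Let w N (p : 'I_N * 'I_N) := (p.1%:R + p.2%:R * be) * t.

(** At integer points the exponentials become powers of e(t) and e(be t). The number t, about whose
    arithmetic nothing is known, survives only in the factor t^k. *)
Lemma exp_jet_term N (c : 'I_N * 'I_N -> int) k m :
  exp_jet (fun p => (c p)%:~R) (@w N) k m%:R = t ^+ k * \sum_p (c p)%:~R *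
    ((p.1%:R + p.2%:R * be) ^+ k * (e t ^+ (p.1 * m) * e (be * t) ^+ (p.2 * m))).
Proof.
rewrite mulr_sumr; apply: eq_bigr => -[i j] _ /=; rewrite /w exprMn -!expX -expD /=.
have -> : t * (i * m)%:R + be * t * (j * m)%:R = (i%:R + j%:R * be) * t * m%:R.
  by rewrite !natrM; ring.
by ring.
Qed.

Lemma gelfond_weight_inj N : injective (@w N).
Proof.
move=> [i j] [i' j'] /(mulIf t_neq0) /= eqw.
have : (i%:Z - i'%:Z)%:~R + (j%:Z - j'%:Z)%:~R * be = 0.
  rewrite !rmorphB /= -!pmulrn mulrBl addrACA -opprD.
  by rewrite eqw subrr.
move=> /be_irrational/eqP; rewrite subr_eq0 eqz_nat => /eqP jj'.
have ii' : (i = i' :> nat).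
  by apply/eqP; rewrite -(eqr_nat C); move/eqP: eqw; rewrite jj' (inj_eq (addIr _)).
by congr (_, _); apply: val_inj.
Qed.

Theorem gelfond_schneider : algebraic (e t) -> algebraic be -> algebraic (e (be * t)) -> False.
Proof.
move=> alg_a alg_b alg_g.
have [q [D [A [B [G [u [q0 [u0 [uA uB uG]]]]]]]]] := algebraic_common_eigen alg_a alg_b alg_g.
have [Ke Ke_gt0 boundK] := exp_sum_bound.
have [b0] := archC (`|t| + `|be * t|); rewrite ger0_norm ?addr_ge0 // => tb0.
have [tau ttau] := archC t^-1.
pose nA X := absz (mxnorm (X : 'M[int]_D)).
have nAE X : mxnorm X = (nA X)%:R by rewrite natz gez0_abs ?mxnorm_ge0.
(* A single positive integer dominating all matrix norms, q and the dimension. *)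
have [b bE] : exists b, b = (nA A + nA B + nA G + nA q%:M + absz q + D + 1)%N by eexists.
have qb : `|q%:~R| <= b%:R :> C.
  rewrite -intr_norm -[b%:R](rmorph_nat (intmul 1)) ler_int bE; lia.
have b_gt0 : (0 < b)%N by rewrite bE addn1.
have [M ME] : exists M, M = (2 * (D + 3))%N by eexists.
(* With this E, N^2 = E n = 2 (n M D^2): twice as many unknowns c_p as matrix entries to
   annihilate. *)
have [E EE] : exists E, E = (2 * D * D * M)%N by eexists.
have D_gt0 : (0 < D)%N.
  by case: (D) u u0 {uA uB uG} => // u; rewrite thinmx0 eqxx.
have M_gt0 : (0 < M)%N by rewrite ME muln_gt0 addn3.
have E_gt0 : (0 < E)%N by rewrite EE !muln_gt0 D_gt0.
have [r r_gt0 param] := 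
  @gelfond_parameters D b tau.+1 Ke b0 M E b_gt0 (ltn0Sn tau) Ke_gt0 E_gt0 ME.
have [N NE] : exists N, N = (E * r)%N by eexists.
have [n nE] : exists n, n = (E * (r * r))%N by eexists.
pose P k := (b ^ 3 * b ^ (2 * N * M) * (2 * N * b) ^ k)%N; pose H := (2 * (N * N) * P n)%N.
have N_gt0 : (0 < N)%N by rewrite NE muln_gt0 E_gt0.
have Nb_gt0 : (0 < 2 * N * b)%N by rewrite !muln_gt0 N_gt0.
have termP k m p : (m <= M)%N -> mxnorm (gelfond_term (N := N) q A B G k m p) <= (P k)%:R.
  move=> mM; apply: gelfond_term_norm => //; rewrite ?nAE ?ler_nat ?bE; try lia.
have cardI : #|{: 'I_N * 'I_N}| = (N * N)%N by rewrite card_prod card_ord.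
have P_gt0 k : (0 < P k)%N by rewrite /P muln_gt0 expn_gt0 Nb_gt0 muln_gt0 !expn_gt0 b_gt0.
(* The equations ask each of the D^2 entries of the matrix sum to vanish, for all orders k < n and
   points m < M. This forces F k m = 0, as u is nonzero. *)
have [|||c [c_neq0 csum cH]] := @siegel ('I_N * 'I_N)%type ('I_n * 'I_M * ('I_D * 'I_D))%type
    (fun j p => gelfond_term q A B G j.1.1 j.1.2 p j.2.1 j.2.2) (P n) (P_gt0 n).
- by rewrite cardI muln_gt0 N_gt0.
- rewrite cardI !card_prod !card_ord.
  rewrite (_ : N * N = 2 * (n * M * (D * D)))%N // NE nE mulnACA {2}EE; ring.
- move=> [[k m] [i j]] p /=; rewrite (le_trans (mxnorm_coef _ _ _)) //.
  rewrite (le_trans (termP _ _ _ (ltnW (ltn_ord m)))) // ler_nat leq_mul2l leq_pexp2l ?orbT //.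
  exact: ltnW.
rewrite cardI -/H in cH.
pose X k m := \sum_p c p *: gelfond_term q A B G k m p.
pose F k m := \sum_p (c p)%:~R *
    ((p.1%:R + p.2%:R * be) ^+ k * (e t ^+ (p.1 * m) * e (be * t) ^+ (p.2 * m))).
have uX k m : eigen u (X k m) (q%:~R ^+ (k + 2 * N * m) * F k m).
  rewrite /F mulr_sumr; apply: eigen_sum => p; rewrite mulrCA; apply: eigenZ.
  exact: gelfond_term_eigen.
have jetF k m : exp_jet (fun p => (c p)%:~R) (@w N) k m%:R = t ^+ k * F k m.
  exact: exp_jet_term.
have qC : q%:~R != 0 :> C by rewrite intr_eq0.
have F0 k m : (k < n)%N -> (m < M)%N -> F k m = 0.
  move=> kn mM; have X0 : X k m = 0.
    apply/matrixP => i j; rewrite /X summxE mxE -[RHS](csum (Ordinal kn, Ordinal mM, (i, j))).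
    by apply: eq_bigr => p _; rewrite mxE mulrC.
  have /eqP := uX k m; rewrite X0 map_mx0 mulmx0 eq_sym scaler_eq0 (negPf u0) orbF.
  by rewrite mulf_eq0 expf_eq0 (negPf qC) andbF => /eqP.
(* If all derivatives at 0 of order below N^2 vanished, the N^2 distinct weights would force c = 0.
   Hence also s < N^2. *)
have exs : exists k, [exists m : 'I_M, F k m != 0] && (k < N * N)%N.
  have [/existsP[k Fk]|none] := boolP [exists k : 'I_(N * N), F k 0 != 0].
    exists k; rewrite ltn_ord andbT; apply/existsP; by exists (Ordinal M_gt0).
  case: c_neq0 => p; have : (c p)%:~R = 0 :> C.
    apply: (@power_sums_eq0 C _ (fun p => (c p)%:~R) _ (@gelfond_weight_inj N) _ p) => k kI.
    have kN : (k < N * N)%N by rewrite -cardI.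
    rewrite -[LHS](_ : exp_jet (fun p => (c p)%:~R) (@w N) k 0%:R = _); last first.
      by apply: eq_bigr => i _; rewrite mulr0 exp0 mulr1.
    rewrite jetF; move: none; rewrite negb_exists => /forallP/(_ (Ordinal kN)).
    by rewrite negbK => /eqP -> ; rewrite mulr0.
  by move/eqP; rewrite intr_eq0 => ->.
case: (ex_minnP exs) => s /andP[/existsP[m Fm] sN] min_s.
have ns : (n <= s)%N.
  by rewrite leqNgt; apply: contra Fm => sn; rewrite F0.
have Fs k m' : (k < s)%N -> (m' < M)%N -> F k m' = 0.
  move=> ks mM; apply/eqP; apply: contraT => Fk.
  have /min_s : [exists m, F k (m : 'I_M) != 0] && (k < N * N)%N.
    by rewrite (ltn_trans ks sN) andbT; apply/existsP; exists (Ordinal mM).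
  by rewrite leqNgt ks.
have := param s N n NE nE; rewrite ns sN => /(_ isT).
(* The choice of r bounds the product strictly by r^(s M); what follows proves the opposite
   inequality. *)
rewrite -/P -/H -(ltr_nat C) => /lt_geF/negP; apply.
set L := (D`! * _ ^ D)%N; set Z := (s`! * _ * _)%N.
set z := q%:~R ^+ (s + 2 * N * m) * F s m.
have z_neq0 : z != 0 by rewrite mulf_neq0 // expf_neq0.
have sumI (a : nat) (K : numDomainType) : (N * N * a)%:R = \sum_(p : 'I_N * 'I_N) a%:R :> K.
  by rewrite sumr_const cardI natrM mulr_natl.
have z_ge : 1 <= `|z| * L%:R.
  apply: norm_int_eigenvalue_ge z_neq0 (uX s m) => //.
  rewrite (le_trans (mxnorm_sum _ _ _)) // sumI ler_sum // => p _.
  by rewrite mxnormZ natrM ler_pM ?mxnorm_ge0 // termP // ltnW.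
have z_le : `|z| <= (b ^ (s + 2 * N * M))%:R * `|F s m|.
  rewrite normrM ler_wpM2r // normrX; apply: (@le_trans _ _ (b%:R ^+ (s + 2 * N * m))).
    by rewrite lerXn2r ?nnegrE.
  by rewrite -!natrX ler_nat leq_pexp2l // leq_add2l leq_mul2l ltnW ?orbT.
pose y : C := m%:R; pose xs : seq C := [seq k%:R | k <- iota 0 M].
have yxs : y \in xs by rewrite map_f // mem_iota /=.
have uxs : uniq xs.
  by rewrite map_inj_uniq ?iota_uniq // => i j /eqP; rewrite eqr_nat => /eqP.
have szxs : size xs = M by rewrite size_map size_iota.
have xsM : {in xs, forall x, `|x| <= M%:R}.
  by move=> x /mapP[k]; rewrite mem_iota => /ltnW kM ->; rewrite normr_nat ler_nat.
have jet_le : (r ^ (s * M))%:R * `|exp_jet (fun p => (c p)%:~R) (@w N) s y| <= Z%:R :> C.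
  have wn p : `|w (N := N) p| * (r + M)%:R <= (b0 * N * (r + M))%:R.
    rewrite [leRHS]natrM ler_wpM2r // /w mulrDl -mulrA (le_trans (ler_normD _ _)) //.
    rewrite !normrM !normr_nat natrM (le_trans _ (ler_wpM2r _ tb0)) // mulrDl normrM.
    by rewrite lerD // mulrC ler_wpM2l ?mulr_ge0 // ler_nat ltnW.
  (* The nodes lie in the disc of radius M; the outer radius r + M makes the difference of the radii
     exactly r. *)
  have := @exp_jet_bound _ (fun p => (c p)%:~R) (@w N) xs s y (r + M)%:R M%:R _ _ boundK uxs yxs.
  rewrite szxs natrD addrK => /(_ (b0 * N * (r + M))%N _ _ xsM) jb.
  rewrite natrX (le_trans (jb _ _ _ _)) //.
  - by rewrite -natrM ler1n muln_gt0 M_gt0.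
  - by rewrite lerDr.
  - by move=> p; rewrite -natrD; apply: wn.
  - by move=> x /mapP[k]; rewrite mem_iota => kM -> l ls; rewrite jetF Fs ?mulr0.
  rewrite -natrM -natrX -natrM [leRHS]natrM ler_wpM2l // [leRHS]natrM ler_wpM2r //.
  rewrite sumI ler_sum // => p _.
  by rewrite -intr_norm -[H%:R](rmorph_nat (intmul 1)) ler_int.
have F_le : `|F s m| <= (tau.+1 ^ s)%:R * `|exp_jet (fun p => (c p)%:~R) (@w N) s y|.
  rewrite jetF -{1}[F s m](mulKf (expf_neq0 s t_neq0)) normrM ler_wpM2r //.
  rewrite normfV normrX -exprVn -normfV natrX lerXn2r ?nnegrE //.
  by rewrite (le_trans ttau) // ler_nat.
(* Insert |z| L >= 1, then bound |z| by |F|, |F| by the jet, and the jet by the Schwarz estimate. *)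
apply: (@le_trans _ _ ((r ^ (s * M))%:R * (`|z| * L%:R))); first by rewrite ler_peMr.
rewrite [leRHS]natrM [(b ^ _ * L)%:R]natrM mulrCA.
apply: (@le_trans _ _ (((b ^ (s + 2 * N * M))%:R * `|F s m|) * ((r ^ (s * M))%:R * L%:R))).
  by rewrite ler_wpM2r ?mulr_ge0.
rewrite -!mulrA ler_wpM2l // mulrA mulrC ler_wpM2l // natrM mulrC.
apply: (@le_trans _ _ ((r ^ (s * M))%:R *
  ((tau.+1 ^ s)%:R * `|exp_jet (fun p => (c p)%:~R) (@w N) s y|))).
  by rewrite ler_wpM2l.
by rewrite mulrCA ler_wpM2l.
Qed.

End GelfondSchneider.
End ExponentialSums.

(** * Complex numbers over the Stdlib reals *)

Definition toC (z : Cplx) : R[i] := Complex (fst z) (snd z).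
Definition cexp (z : R[i]) : R[i] := toC (Cexp (Re z, Im z)).

Lemma toC_Cadd z w : toC (Cadd z w) = toC z + toC w.
Proof. by []. Qed.

Lemma toC_Cmul z w : toC (Cmul z w) = toC z * toC w.
Proof. by []. Qed.

Lemma toC_Cpow z n : toC (Cpow z n) = toC z ^+ n.
Proof. by elim: n => [|n IHn] //=; rewrite exprS -IHn. Qed.

Lemma cexp_toC z : cexp (toC z) = toC (Cexp z).
Proof. by case: z. Qed.

Lemma cexpD z w : cexp (z + w) = cexp z * cexp w.
Proof. by case: z w => [a b] [c d]; rewrite /cexp -toC_Cmul -Cexp_add. Qed.

Lemma complex_arch (z : R[i]) : exists n : nat, `|z| <= n%:R.
Proof.
rewrite normc_def; set r := Num.sqrt _; exists (Num.bound r).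
by rewrite -[_%:R](rmorph_nat (real_complex R)) lecR ltW // archi_boundP ?sqrtr_ge0.
Qed.

Lemma complex_norm_le (z : R[i]) : `|z| <= real_complex R (`|Re z| + `|Im z|).
Proof.
rewrite normc_def lecR -[leRHS]ger0_norm ?addr_ge0 // -sqrtr_sqr ler_wsqrtr // sqrrD.
by rewrite !real_normK ?num_real // addrAC lerDl mulrn_wge0 ?mulr_ge0.
Qed.

Lemma toC_divn z n : toC z / n%:R = toC (fst z / INR n, snd z / INR n).
Proof.
case: z => a b; rewrite INRE -[n%:R](rmorph_nat (real_complex R)) -fmorphV.
rewrite /toC /=; apply/eqP; rewrite eq_complex /= !mulr0 subr0.
by rewrite add0r !eqxx.
Qed.

Lemma fact_factorial n : fact n = n`!.
Proof. by elim: n => //= n ->; rewrite factS. Qed.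

Lemma exp_poly_toC w n : (exp_poly (toC w) n.+1).[1] =
  toC (sum_f_R0 (fun k => fst (Cpow w k) / INR (fact k)) n,
       sum_f_R0 (fun k => snd (Cpow w k) / INR (fact k)) n).
Proof.
rewrite exp_polyE mulr1; elim: n => [|n IHn].
  by rewrite big_ord1 -toC_Cpow -fact_factorial toC_divn.
by rewrite big_ord_recr IHn -toC_Cpow -fact_factorial toC_divn.
Qed.

Lemma exp_poly_cvg (w eps : R[i]) : 0 < eps -> exists T0, forall T, (T0 <= T)%N ->
  `|(exp_poly w T).[1] - cexp w| <= eps.
Proof.
(* A positive element of [R[i]] has zero imaginary part; half of its real part is allotted to each
   coordinate. *)
case: w eps => a b [e e']; rewrite ltcE /= => /andP[/eqP e'0 e0].
have /RltP e20 : 0 < e / 2 by rewrite divr_gt0.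
have [N cvN] := @Cexp_cv (a, b) _ e20; exists N.+1 => -[//|T] NT.
have /cvN[/RleP cvr /RleP cvi] : (N <= T)%coq_nat by apply/ssrnat.leP.
rewrite -[Complex a b]/(toC (a, b)) exp_poly_toC cexp_toC.
by apply: le_trans (complex_norm_le _) _; rewrite e'0 lecR /= [leRHS]splitr lerD.
Qed.

Lemma IZR_int (a : Z) : (int_of_Z a)%:~R = IZR a :> R.
Proof.
case: a => [//|p|p] /=; first by rewrite IZRposE -Pos_to_natE INRE.
rewrite NegzE prednK; last exact/ssrnat.ltP/Pos2Nat.is_pos.
by rewrite rmorphN /= -[IZR (Z.neg p)]/(- IZR (Z.pos p)) IZRposE -Pos_to_natE INRE.
Qed.

Lemma intr_toC (a : Z) : (int_of_Z a)%:~R = toC (CofZ a).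
Proof. by rewrite -(rmorph_int (real_complex R)) /= IZR_int. Qed.

(** [Peval] is Horner's rule with the constant term first, the order in which [Poly] reads a list.
    [Poly] drops only trailing zeros, so a nonzero entry keeps it nonzero. *)
Lemma is_algebraic_toC z : is_algebraic z -> algebraic (toC z).
Proof.
move=> [p [[a [ap a0]] pz]]; exists (Poly [seq int_of_Z x | x <- p]).
  apply/eqP => p0; apply: a0; elim: p p0 ap {pz} => //= x l IHl.
  rewrite cons_poly_def => xl; have /eqP x0 := congr1 (coefp 0) xl.
  move: x0 xl; rewrite /= coefD coefMX coefC add0r coef0 => /eqP x0.
  rewrite x0 addr0 => /eqP; rewrite mulf_eq0 polyX_eq0 orbF => /eqP /IHl l0 [xa|//].
  by rewrite -xa -[x]int_of_ZK x0.
rewrite /root; suff -> : forall l, (map_poly intr (Poly [seq int_of_Z x | x <- l])).[toC z] =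
    toC (Peval l z) by rewrite pz.
elim=> [|x l IHl] /=; first by rewrite rmorph0 horner0.
rewrite cons_poly_def rmorphD rmorphM /= map_polyX map_polyC hornerMXaddC IHl addrC.
rewrite mulrC -toC_Cmul toC_Cadd; congr (_ + _).
exact: intr_toC.
Qed.

(** The reversed polynomial vanishes at 1/z; it is nonzero because its constant term is the leading
    coefficient of p. *)
Lemma algebraicV (K : numFieldType) (z : K) : algebraic z -> algebraic z^-1.
Proof.
have [->|z0] := eqVneq z 0; first by rewrite invr0.
move=> [p p0 rootz]; pose n := (size p).-1; exists (\poly_(i < n.+1) p`_(n - i)).
  apply/eqP => /polyP/(_ 0%N)/eqP; rewrite coef_poly coef0 /= subn0.
  by rewrite -[p`_n]/(lead_coef p) lead_coef_eq0 (negPf p0).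
have sz : size p = n.+1 by rewrite prednK // size_poly_gt0.
rewrite /root; suff -> : (map_poly intr (\poly_(i < n.+1) p`_(n - i))).[z^-1] =
    z^-1 ^+ n * (map_poly intr p).[z] by rewrite (rootP rootz) mulr0.
have -> : map_poly intr (\poly_(i < n.+1) p`_(n - i)) =
    \poly_(i < n.+1) (p`_(n - i))%:~R :> {poly K}.
  by apply/polyP => i; rewrite coef_map !coef_poly; case: ifP.
rewrite horner_poly horner_coef size_map_inj_poly ?rmorph0 //; last exact: intr_inj.
rewrite sz mulr_sumr (reindex_inj rev_ord_inj); apply: eq_bigr => i _ /=.
have le_in : (i <= n)%N by rewrite -ltnS.
rewrite subSS subKn // coef_map /= mulrCA; congr (_ * _).
by rewrite -[X in _ = _ ^+ X * _](subnK le_in) exprD -mulrA -exprMn mulVf // expr1n mulr1.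
Qed.

Close Scope ring_scope.
(* mathcomp's poly also has a constant root_of_unity. *)
Import Defs.
Open Scope R_scope.

Theorem theorem2p5 (t : Cplx) :
  (Cnorm2 t < 1 \/ root_of_unity t) ->
  is_algebraic (Cexp (Cmul t (Cexp (Copp t)))) ->
  is_algebraic (Cexp t) ->
  snd (Cexp (Cmul t (Cexp (Copp t)))) = 0 /\ 0 < fst (Cexp (Cmul t (Cexp (Copp t)))).
Proof.
move=> t_small alg_x alg_h.
have norm_le : Cnorm2 t <= 1 by case: t_small => [/Rlt_le|/root_of_unity_norm].
(* It remains to show that e^(-t) is real. *)
apply: Cexp_mul_opp_pos norm_le _.
Open Scope ring_scope.
set z := toC t; set be := toC (Cexp (Copp t)).
have be_inv : cexp z * be = 1.
  rewrite cexp_toC /be -toC_Cmul -Cexp_add /Cadd /Copp /=.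
  by rewrite !Rplus_opp_r /Cexp /= exp_0 cos_0 sin_0 Rmult_1_l Rmult_0_r.
have be_eq : be = (cexp z)^-1.
  by apply: (mulfI (x := cexp z)); rewrite ?be_inv ?divff //; apply/eqP => e0;
    move/eqP: be_inv; rewrite e0 mul0r eq_sym oner_eq0.
have alg_be : algebraic be by rewrite be_eq cexp_toC; apply/algebraicV/is_algebraic_toC.
have [z0|z_neq0] := eqVneq z 0.
  have y0 : snd t = IZR 0 := congr1 (@Im _) z0.
  by rewrite /Copp /Cexp /= y0 Ropp_0 sin_0 Rmult_0_r.
have [be_rat|be_irr] := classic (exists a b : int, a%:~R + b%:~R * be = 0 /\ b <> 0).
  have [a [b [ab0 /eqP b0]]] := be_rat.
  (* The imaginary part of a + b be = 0 is b Im(be) = 0 with b nonzero, so be is real. *)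
  have /(congr1 (@Im _)) := ab0.
  rewrite -!(rmorph_int (real_complex R)) /= mul0r addr0 add0r.
  move/eqP; rewrite mulf_eq0 intr_eq0 (negPf b0) => /eqP; exact.
(* For irrational be, the three numbers e^t, be and e^(be t) = x cannot all be algebraic. *)
case: (@gelfond_schneider _ cexp complex_arch cexpD exp_poly_cvg z be z_neq0).
- move=> a b ab0; apply/eqP; apply: contraT => /eqP b0; case: be_irr; by exists a, b.
- by rewrite cexp_toC; apply: is_algebraic_toC.
- exact: alg_be.
- rewrite mulrC -toC_Cmul cexp_toC; exact: is_algebraic_toC.
Qed.
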